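(* Let $k \ge 5$ and let $G$ be a $k$-list-critical graph that is not a complete graph. Let $\mathcal{L}$ be the subgraph of $G$ induced on the vertices of degree $k-1$ in $G$, let $\mathcal{H}^-$ be the subgraph of $G$ induced on the vertices of degree $k$ in $G$, and let $\mathcal{H}^+$ be the subgraph of $G$ induced on the vertices of degree at least $k+1$ in $G$. Then \[q(\mathcal{L}) \le c^*(\mathcal{L}) + 4|\mathcal{H}^-| + \|\mathcal{H}^+, \mathcal{L}\|,\] and if $k \ge 7$, then \[q(\mathcal{L}) \le 2c^*(\mathcal{L}) + 3|\mathcal{H}^-| + \|\mathcal{H}^+, \mathcal{L}\|.\]
   Context: All graphs are finite and simple. A graph is $m$-choosable if for every assignment of a list of at least $m$ colors to each vertex there is a proper coloring in which each vertex receives a color from its list. A graph $G$ is $k$-list-critical if $G$ is not $(k-1)$-choosable, but every proper subgraph of $G$ is $(k-1)$-choosable. $|X|$ denotes the number of vertices of a graph $X$, and $\|X,Y\|$ denotes the number of edges of $G$ with one end in $X$ and the other in $Y$, for vertex-disjoint subgraphs $X,Y$ of $G$. $c^*(\mathcal{L})$ is the number of components of $\mathcal{L}$ containing a copy of $K_{k-1}$. $q(\mathcal{L})$ is the number of vertices of $\mathcal{L}$ that are not cutvertices of $\mathcal{L}$ and that appear in copies of $K_{k-1}$ in $\mathcal{L}$. *)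

(* Defs.v *)
From HB Require Import structures.
From mathcomp Require Import all_boot.

Set Implicit Arguments.
Unset Strict Implicit.
Unset Printing Implicit Defensive.

Record sgraph := SGraph {
  vertex :> finType;
  adj : rel vertex;
  adj_sym : symmetric adj;
  adj_irrefl : irreflexive adj }.

Definition edges (G : sgraph) : {set {set G}} :=
  [set e | [exists x, exists y, adj x y && (e == [set x; y])]].

Lemma in_edges (G : sgraph) (x y : G) : ([set x; y] \in edges G) = adj x y.
Proof.
rewrite inE; apply/existsP/idP => [[u /existsP[v /andP[uv /eqP E]]]|xy].
  have /set2P xE : x \in [set u; v] by rewrite -E set21.
  have /set2P yE : y \in [set u; v] by rewrite -E set22.
  have /set2P uE : u \in [set x; y] by rewrite E set21.
  have /set2P vE : v \in [set x; y] by rewrite E set22.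
  have uv_neq : u <> v by move=> e; move: uv; rewrite e adj_irrefl.
  case: xE yE uE vE => -> [] -> // [] uE [] vE; by [rewrite adj_sym | case: uv_neq].
by exists x; apply/existsP; exists y; rewrite xy eqxx.
Qed.

Record subgraph (G : sgraph) := Subgraph {
  verts : {set G};
  sedges : {set {set G}};
  sedges_edges : sedges \subset edges G;
  sedges_verts : forall e, e \in sedges -> e \subset verts }.

Section GraphOfSubgraph.
Variables (G : sgraph) (H : subgraph G).

Definition sub_adj : rel {x : G | x \in verts H} :=
  fun x y => [set val x; val y] \in sedges H.

Lemma sub_adj_sym : symmetric sub_adj.
Proof. by move=> x y; rewrite /sub_adj setUC. Qed.

Lemma sub_adj_irrefl : irreflexive sub_adj.
Proof.
move=> x; apply/negP => /(subsetP (sedges_edges H)).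
by rewrite in_edges adj_irrefl.
Qed.

Definition graph_of_subgraph : sgraph := SGraph sub_adj_sym sub_adj_irrefl.

End GraphOfSubgraph.

Coercion graph_of_subgraph : subgraph >-> sgraph.

Definition proper_subgraph (G : sgraph) (H : subgraph G) : bool :=
  (verts H != [set: G]) || (sedges H != edges G).

Section Induced.
Variables (G : sgraph) (S : {set G}).

Lemma induced_edges : [set e in edges G | e \subset S] \subset edges G.
Proof. by apply/subsetP => e; rewrite inE => /andP[]. Qed.

Lemma induced_verts e : e \in [set e in edges G | e \subset S] -> e \subset S.
Proof. by rewrite inE => /andP[]. Qed.

Definition induced : subgraph G := Subgraph induced_edges induced_verts.

End Induced.

(* Colours range over an arbitrary finite type; as graphs are finite, allowing
   infinite colour lists would give the same notion. *)
Definition choosable (m : nat) (G : sgraph) : Prop :=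
  forall (C : finType) (L : G -> {set C}),
    (forall v, m <= #|L v|) ->
    exists f : G -> C,
      (forall v, f v \in L v) /\ (forall u v, adj u v -> f u != f v).

Definition list_critical (k : nat) (G : sgraph) : Prop :=
  ~ choosable k.-1 G /\
  (forall H : subgraph G, proper_subgraph H -> choosable k.-1 H).

Definition complete (G : sgraph) : bool :=
  [forall x : G, forall y : G, (x != y) ==> adj x y].

Definition deg (G : sgraph) (v : G) : nat := #|[set u | adj v u]|.

Definition nverts (G : sgraph) : nat := #|[set: G]|.

(* Only used for vertex-disjoint X and Y. *)
Definition edges_between (G : sgraph) (X Y : subgraph G) : nat :=
  #|[set e in edges G |
      [exists x in verts X, exists y in verts Y, e == [set x; y]]]|.

(* Components are represented by their vertex sets. *)
Definition components (G : sgraph) : {set {set G}} :=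
  [set [set y | connect (@adj G) x y] | x in [set: G]].

Definition cutvertex (G : sgraph) (v : G) : bool :=
  #|components G| < #|components (induced [set~ v])|.

(* A copy of K_n is represented by its vertex set. *)
Definition is_K (n : nat) (G : sgraph) (K : {set G}) : bool :=
  (#|K| == n) && [forall x in K, forall y in K, (x != y) ==> adj x y].

Definition cstar (k : nat) (L : sgraph) : nat :=
  #|[set X in components L | [exists K, is_K k.-1 K && (K \subset X)]]|.

Definition q (k : nat) (L : sgraph) : nat :=
  #|[set v : L | ~~ cutvertex v & [exists K, is_K k.-1 K && (v \in K)]]|.

(* Main.v *)
Require Import Defs.
From mathcomp Require Import all_boot.
From mathcomp Require Import zify.

(* Both inequalities follow from q <= c* + 3|H^-| + ||H^+, L||, which holds for
   all k >= 5.  A vertex counted by q has exactly one neighbour outside L; suppose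
   that for more than c* + 3|H^-| of them this neighbour lies in H^-.  Then there
   are a nonempty set Y of vertices of degree k and a family of components of L
   such that, counting only these edges, each y in Y sends at least 4 to the
   family and each component of the family sends at least 2 to Y.  Prune each
   component to a minimal connected set containing the K_(k-1)'s that carry these
   edges, and colour everything else by criticality.  Now colour Y in a fixed
   order and then the pruned components: a component T can be completed as soon as
   two vertices of one of its K_(k-1)'s, both without T-neighbours outside that
   clique, are left with different lists.  If the list left at one of them is
   known by the time the Y-neighbour y of the other is coloured, then y ensures
   this by avoiding a single colour.  At least two edges of T have this property,
   so by Hall's theorem each component can be charged to one y such that no y is
   charged more than d - 2 times, d being its number of neighbours in the
   family; that many colours are available beyond those of its Y-neighbours. *)

Set Implicit Arguments.
Unset Strict Implicit.
Unset Printing Implicit Defensive.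

(* Boolean hypotheses in the context make [lia] explode; keep only arithmetic ones. *)
Ltac natlia :=
  intros;
  repeat match goal with
  | H : ?P |- _ =>
      lazymatch type of P with
      | Prop => lazymatch P with
                | is_true (leq _ _) => fail
                | @eq nat _ _ => fail
                | _ => clear H
                end
      end
  end; lia.

(** * List colouring of connected sets *)

Section Coloring.
Variable G : sgraph.
Implicit Types (S X Y D A : {set G}) (u v w x y z : G).

Definition nbr S v := [set u in S | adj v u].

Lemma in_nbr S v u : (u \in nbr S v) = (u \in S) && adj v u.
Proof. by rewrite inE. Qed.

Lemma nbrS S X v : S \subset X -> nbr S v \subset nbr X v.
Proof. by move=> /subsetP sSX; apply/subsetP=> u; rewrite !in_nbr => /andP[/sSX-> ->]. Qed.

Lemma nbr_sub S v : nbr S v \subset S.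
Proof. by apply/subsetP=> u; rewrite in_nbr => /andP[]. Qed.

(** Connectivity is stated by cuts rather than paths, since the greedy arguments need an edge
    leaving a given part. The empty set counts as connected. *)
Definition conn S := [forall X : {set G},
  [&& X \subset S, X != set0 & X != S] ==> [exists x in X, exists y in S :\: X, adj x y]].

Lemma connP S :
  reflect (forall X, X \subset S -> X != set0 -> X != S ->
             exists x y, [/\ x \in X, y \in S, y \notin X & adj x y])
          (conn S).
Proof.
apply: (iffP forallP) => [h X XS X0 XnS|h X].
  have /implyP := h X; rewrite XS X0 XnS => /(_ isT) /exists_inP[x xX /exists_inP[y]].
  by rewrite inE => /andP[yX yS] xy; exists x, y.
apply/implyP=> /and3P[XS X0 XnS]; have [x [y [xX yS yX xy]]] := h X XS X0 XnS.
by apply/exists_inP; exists x => //; apply/exists_inP; exists y; rewrite // inE yX.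
Qed.

Definition adjin S : rel G := fun x y => [&& x \in S, y \in S & adj x y].

Definition component S w := [set z | connect (adjin S) w z].

Lemma adjin_sym S : symmetric (adjin S).
Proof. by move=> x y; rewrite /adjin /= adj_sym andbCA. Qed.

Lemma component_id S w : w \in component S w.
Proof. by rewrite inE connect0. Qed.

Lemma component_sub S w : w \in S -> component S w \subset S.
Proof.
move=> wS; apply/subsetP=> z; rewrite inE => /connectP[p].
elim: p w wS => [|y p IH] w wS /=; first by move=> _ ->.
by case/andP=> /and3P[_ yS _] hp; apply: IH.
Qed.

Lemma component_closed S w x y :
  w \in S -> x \in component S w -> y \in S -> adj x y -> y \in component S w.
Proof.
move=> wS xD yS xy; have xS := subsetP (component_sub wS) _ xD.
move: xD; rewrite !inE => h; apply: (connect_trans h); apply: connect1.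
by rewrite /adjin xS yS.
Qed.

Lemma component_conn S w : w \in S -> conn (component S w).
Proof.
move=> wS; apply/connP=> X XD /set0Pn[a aX] XnD.
have [z zD zX] : exists2 z, z \in component S w & z \notin X.
  by apply/subsetPn; apply: contraNN XnD => ?; rewrite eqEsubset XD.
have aD := subsetP XD _ aX.
have : connect (adjin S) a z.
  move: aD zD; rewrite !inE => wa; apply: connect_trans.
  by rewrite (sym_connect_sym (@adjin_sym S)).
case/connectP=> p; elim: p a aX aD => [|b p IH] a aX aD /=.
  by move=> _ e; rewrite e aX in zX.
case/andP=> /and3P[aS bS ab] hp hz.
have bD := component_closed wS aD bS ab.
by have [bX|bX] := boolP (b \in X); [exact: (IH b) | exists a, b].
Qed.

Lemma conn_sub_component S w X x :
  w \in S -> conn X -> X \subset S -> x \in X -> x \in component S w -> X \subset component S w.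
Proof.
move=> wS /connP cX XS xX xD; apply/negPn/negP=> nXD.
have [|||a [b [/setIP[aX aD] bX]]] := cX (X :&: component S w).
- exact: subsetIl.
- by apply/set0Pn; exists x; rewrite inE xX.
- by apply: contraNN nXD => /eqP/setIidPl.
rewrite inE bX /= => /negP bD ab; apply: bD.
exact: component_closed aD (subsetP XS _ bX) ab.
Qed.

Lemma conn1 x : conn [set x].
Proof.
apply/connP=> X; rewrite subset1 => /orP[] /eqP ->; last by rewrite eqxx.
by move=> _; rewrite eqxx.
Qed.

Lemma conn_setU S X x z : conn S -> conn X -> x \in S -> z \in X -> adj x z -> conn (S :|: X).
Proof.
(* Either [Z] meets [V], and connectivity of [V] gives a crossing edge, or [Z] contains [U] and the
   joining edge [ab] crosses. *)
have half (U V Z : {set G}) a b : conn V -> a \in U -> b \in V -> adj a b ->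
    Z \subset U :|: V -> Z != U :|: V -> U \subset Z \/ Z :&: V != set0 -> ~~ (V \subset Z) ->
    exists p q, [/\ p \in Z, q \in U :|: V, q \notin Z & adj p q].
  move=> /connP cV aU bV ab ZUV ZnUV h VZ.
  have [ZV0|ZV] := eqVneq (Z :&: V) set0.
    case: h => [UZ|]; last by rewrite ZV0 eqxx.
    exists a, b; split=> //; [exact: (subsetP UZ) | by rewrite inE bV orbT |].
    by apply/negP=> bZ; have := in_set0 b; rewrite -ZV0 inE bZ bV.
  have [|//||p [q [/setIP[pZ _] qV qZ pq]]] := cV (Z :&: V).
  - exact: subsetIr.
  - by apply: contraNN VZ => /eqP/setIidPr.
  exists p, q; split=> //; first by rewrite inE qV orbT.
  by apply: contraNN qZ => ?; rewrite inE qV andbT.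
move=> cS cX xS zX xz; apply/connP=> Z ZS Z0 ZnS.
have [SZ|nSZ] := boolP (S \subset Z).
  have nXZ : ~~ (X \subset Z).
    by apply: contraNN ZnS => XZ; rewrite eqEsubset ZS subUset SZ XZ.
  by apply: (half S X Z x z) => //; left.
have [XZ|nXZ] := boolP (X \subset Z).
  by rewrite setUC; apply: (half X S Z z x) => //; rewrite 1?adj_sym 1?setUC //; left.
have [a aZ] := set0Pn _ Z0; have /setUP[aS|aX] := subsetP ZS _ aZ.
  rewrite setUC; apply: (half X S Z z x) => //; rewrite 1?adj_sym 1?setUC //; right.
  by apply/set0Pn; exists a; rewrite inE aZ.
apply: (half S X Z x z) => //; right.
by apply/set0Pn; exists a; rewrite inE aZ.
Qed.

Lemma conn_setU1 S x z : conn S -> x \in S -> adj x z -> conn (z |: S).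
Proof.
move=> cS xS xz; rewrite setUC.
exact: conn_setU cS (conn1 z) xS (set11 z) xz.
Qed.

Definition clique A := forall x y, x \in A -> y \in A -> x != y -> adj x y.

Lemma conn_clique A : clique A -> conn A.
Proof.
move=> cA; apply/connP=> X XA /set0Pn[a aX] XnA.
have [b bA bX] : exists2 z, z \in A & z \notin X.
  by apply/subsetPn; apply: contraNN XnA => ?; rewrite eqEsubset XA.
exists a, b; split=> //; apply: cA => //; first exact: (subsetP XA).
by apply: contraNneq bX => <-.
Qed.

Lemma cliqueS A X : clique A -> X \subset A -> clique X.
Proof. by move=> cA /subsetP XA x y /XA ? /XA ?; exact: cA. Qed.

(** * Greedy list colouring *)

Section Lists.
Variable C : finType.
Implicit Type L : G -> {set C}.

Definition colorable S L := exists f : G -> C,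
  (forall x, x \in S -> f x \in L x) /\
  (forall x y, x \in S -> y \in S -> adj x y -> f x != f y).

(** The hypothesis is a degeneracy condition: the vertex it provides for [S] itself is coloured
    last, when its neighbours block fewer colours than its list holds. [c0] serves the empty [S]. *)
Lemma greedy_colorable (c0 : C) S L :
  (forall X, X \subset S -> X != set0 -> exists2 x, x \in X & #|nbr X x| < #|L x|) ->
  colorable S L.
Proof.
have [n] := ubnP #|S|; elim: n S => // n IH S /ltnSE hS h.
have [->|S0] := eqVneq S set0.
  by exists (fun=> c0); split=> [x|x y]; rewrite inE.
have [x xS hx] := h S (subxx _) S0.
have [||f [fL fP]] := IH (S :\ x).
- by move: hS; rewrite (cardsD1 x S) xS.
- by move=> X XS; apply: h; apply: subset_trans XS (subsetDl _ _).
have : 0 < #|L x :\: (f @: nbr S x)|.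
  rewrite cardsD subn_gt0; apply: leq_ltn_trans hx.
  by apply: leq_trans (leq_imset_card f _); rewrite subset_leq_card // subsetIr.
case/card_gt0P=> c /setDP[cL cf].
exists (fun z => if z == x then c else f z); split=> [z zS|y z yS zS yz].
  by case: eqP => [->//|/eqP zx]; apply: fL; rewrite !inE zx.
have c_neq t : t \in S -> adj x t -> c != f t.
  by move=> tS xt; apply: contraNneq cf => ->; apply: imset_f; rewrite inE tS.
case: (eqVneq y x) (eqVneq z x) => [yx|yx] [zx|zx].
- by rewrite yx zx adj_irrefl in yz.
- by apply: c_neq => //; rewrite -yx.
- by rewrite eq_sym; apply: c_neq => //; rewrite -zx adj_sym.
- by apply: fP; rewrite // !inE ?yx ?zx.
Qed.

(** Colour towards the root [v], which has a spare colour: a part that misses [v] has an edge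
    leaving it, and the inner end of that edge has fewer neighbours in the part than in [S]. *)
Lemma conn_colorable (c0 : C) S L v :
  conn S -> (forall x, x \in S -> #|nbr S x| <= #|L x|) ->
  v \in S -> #|nbr S v| < #|L v| -> colorable S L.
Proof.
move=> /connP cS hL vS hv; apply: greedy_colorable => // X XS X0.
have [vX|vX] := boolP (v \in X).
  by exists v => //; apply: leq_ltn_trans hv; apply/subset_leq_card/nbrS.
have [|x [y [xX yS yX xy]]] := cS X XS X0; first by apply: contraNneq vX => ->.
exists x => //; apply: leq_trans (hL x (subsetP XS _ xX)).
apply: proper_card; apply/properP; split; first exact: nbrS.
by exists y; rewrite !in_nbr ?yS // (negPf yX).
Qed.

(** Give [v] the colour [a]. Each neighbour of [v] loses one neighbour and at most one colour, and
    [u] loses no colour, so [u] can be the root in [S :\ v]. *)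
Lemma noncut_colorable (c0 : C) S L u v a :
  conn (S :\ v) -> (forall x, x \in S -> #|nbr S x| <= #|L x|) ->
  v \in S -> u \in S -> adj v u -> a \in L v -> a \notin L u -> colorable S L.
Proof.
move=> cS hL vS uS vu av au.
pose L' z := if adj v z then L z :\ a else L z.
have uv : u != v by apply: contraTneq vu => ->; rewrite adj_irrefl.
have nE z : z \in S -> z != v -> #|nbr S z| = adj v z + #|nbr (S :\ v) z|.
  move=> zS zv; rewrite (cardsD1 v (nbr S z)) in_nbr vS /= adj_sym; congr (_ + _).
  by apply: eq_card => t; rewrite !inE andbA.
have [|x /setD1P[xv xS]|||f [fL fP]] := @conn_colorable c0 (S :\ v) L' u; rewrite ?inE ?uv //.
- have := hL x xS; rewrite nE // /L'; case: adj => //=.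
  by have := cardsD1 a (L x); case: (a \in L x); natlia.
- have := hL u uS; rewrite nE // /L' vu.
  by have := cardsD1 a (L u); rewrite (negPf au) !add0n => ->; natlia.
have a_neq t : t \in S -> adj v t -> a != f t.
  move=> tS vt; have tv : t != v by apply: contraTneq vt => ->; rewrite adj_irrefl.
  by have := fL t; rewrite !inE tv tS /L' vt => /(_ isT) /setD1P[]; rewrite eq_sym.
exists (fun z => if z == v then a else f z); split=> [z zS|y z yS zS yz].
  case: eqP => [->//|/eqP zv]; have := fL z; rewrite !inE zv zS /L' => /(_ isT).
  by case: adj => // /setD1P[].
case: (eqVneq y v) (eqVneq z v) => [yx|yx] [zx|zx].
- by rewrite yx zx adj_irrefl in yz.
- by apply: a_neq => //; rewrite -yx.
- by rewrite eq_sym; apply: a_neq => //; rewrite -zx adj_sym.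
- by apply: fP; rewrite // !inE ?yx ?zx.
Qed.

(** All neighbours of [v] lie in the clique, so a connection through [v] can bypass it inside
    [A]. *)
Lemma conn_setD1_clique S A v :
  conn S -> clique A -> A \subset S -> v \in A -> nbr S v \subset A -> conn (S :\ v).
Proof.
move=> /connP cS cA AS vA nv; apply/connP=> X XS /set0Pn[a aX] XnS.
have vX : v \notin X by apply/negP=> /(subsetP XS); rewrite !inE eqxx.
have [XA0|[c]] := set_0Vmem (X :&: A).
  have [|||x [y [xX yS yX xy]]] := cS X.
  - exact: subset_trans XS (subsetDl _ _).
  - by apply/set0Pn; exists a.
  - by apply: contraNneq vX => ->; apply: (subsetP AS).
  have xS : x \in S by have /setD1P[] := subsetP XS _ xX.
  exists x, y; split=> //; rewrite !inE yS andbT; apply: contraTneq xy => ->.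
  apply/negP=> xv; have := in_set0 x; rewrite -XA0 inE xX (subsetP nv) //.
  by rewrite in_nbr xS adj_sym.
case/setIP=> cX cA'; have [AX|] := boolP (A :\ v \subset X); last first.
  case/subsetPn=> y /setD1P[yv yA] yX.
  exists c, y; split=> //; first by rewrite !inE yv (subsetP AS).
  by apply: cA => //; apply: contraNneq yX => <-.
have [|||x [y [xX yS yX xy]]] := cS (v |: X).
- by apply/subsetP=> t /setU1P[->|/(subsetP XS)/setD1P[]//]; apply: (subsetP AS).
- by apply/set0Pn; exists v; rewrite setU11.
- by apply: contraNneq XnS => <-; rewrite setU1K.
have [yv yX'] : y != v /\ y \notin X by apply/andP; move: yX; rewrite !inE negb_or.
exists x, y; split=> //; last by rewrite !inE yv.
case/setU1P: xX => // xv; case/negP: yX'; apply: (subsetP AX).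
by rewrite !inE yv (subsetP nv) // in_nbr yS -xv.
Qed.

Lemma card_nbr_clique S A v :
  clique A -> A \subset S -> v \in A -> nbr S v \subset A -> #|nbr S v| = #|A|.-1.
Proof.
move=> cA AS vA nv; rewrite (cardsD1 v A) vA; apply: eq_card => t; rewrite !inE.
have [->|tv] /= := eqVneq t v; first by rewrite adj_irrefl andbF.
apply/idP/idP=> [/andP[tS vt]|tA]; first by rewrite (subsetP nv) // in_nbr tS.
by rewrite (subsetP AS) //= cA // eq_sym.
Qed.

(** If the lists differ, one of [u] and [v] has a colour missing at the other, and neither is a
    cutvertex of [S]. If [L v] has [#|A|] colours, it exceeds the degree of [v], which is then a
    root. *)
Lemma clique_colorable (c0 : C) S A L u v :
  conn S -> (forall x, x \in S -> #|nbr S x| <= #|L x|) ->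
  clique A -> A \subset S -> u \in A -> v \in A ->
  nbr S u \subset A -> nbr S v \subset A ->
  L u != L v \/ #|A| <= #|L v| -> colorable S L.
Proof.
move=> cS hL cA AS uA vA nu nv; have uS := subsetP AS _ uA; have vS := subsetP AS _ vA.
have big t : t \in A -> nbr S t \subset A -> #|A| <= #|L t| -> colorable S L.
  move=> tA nt h; apply: (@conn_colorable c0 S L t) => //; first exact: (subsetP AS).
  by rewrite (card_nbr_clique cA) //; apply: leq_trans h; rewrite (cardsD1 t) tA.
case=> [Luv|]; last exact: big.
have uv : u != v by apply: contraNneq Luv => ->.
have vu : v != u by rewrite eq_sym.
have [/subsetPn[a au av]|sub] := boolP (~~ (L u \subset L v)).
  apply: (@noncut_colorable c0 S L v u a) => //; last exact: cA.
  exact: conn_setD1_clique nu.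
have [/subsetPn[a au av]|sub'] := boolP (~~ (L v \subset L u)).
  apply: (@noncut_colorable c0 S L u v a) => //; last exact: cA.
  exact: conn_setD1_clique nv.
by case/negP: Luv; rewrite eqEsubset (negbNE sub) (negbNE sub').
Qed.

End Lists.
End Coloring.

(** * Bipartite extraction and Hall's theorem with capacities *)

(** Take [Q] inclusion-minimal with the inequality. Deleting a whole fibre of [f] lowers the left
    side by at least [a], so by minimality the fibre has more than [a] elements; likewise for [g]
    and [b]. *)
Lemma extract_fibers (E V1 V2 : finType) (P : {set E}) (f : E -> V1) (g : E -> V2) a b :
  a * #|f @: P| + b * #|g @: P| < #|P| ->
  exists Q : {set E}, [/\ Q \subset P, Q != set0 &
    forall x, x \in Q -> a < #|[set z in Q | f z == f x]| /\ b < #|[set z in Q | g z == g x]|].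
Proof.
move=> hP; pose pr (Q : {set E}) := (Q \subset P) && (a * #|f @: Q| + b * #|g @: Q| < #|Q|).
have [|Q /minsetP[/andP[QP hQ] Qmin] _] := @minset_exists _ pr P; first by rewrite /pr subxx.
exists Q; split=> // [|x xQ]; first by apply: contraTneq hQ => ->; rewrite cards0 ltn0.
have shrink (V : finType) (h : E -> V) :
    let Z := [set z in Q | h z != h x] in
    [/\ #|Q| = #|[set z in Q | h z == h x]| + #|Z|, Z \subset Q, Z != Q & #|h @: Z| < #|h @: Q|].
  move=> Z; have ZQ : Z \subset Q by apply/subsetP=> z; rewrite inE => /andP[].
  split=> //.
  - rewrite -(cardsID [set z | h z == h x]); congr (_ + _); apply: eq_card => z; rewrite !inE //.
    by rewrite andbC.
  - by apply: contraTneq xQ => <-; rewrite !inE eqxx andbF.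
  apply/proper_card/properP; split; first exact: imsetS.
  exists (h x); first exact: imset_f.
  by apply/imsetP=> -[z]; rewrite inE => /andP[_ /negP zx] e; apply: zx; rewrite e.
have minZ (Z : {set E}) : Z \subset Q -> Z != Q -> #|Z| <= a * #|f @: Z| + b * #|g @: Z|.
  move=> ZQ ZnQ; rewrite leqNgt; apply: contra ZnQ => h.
  by apply/eqP/Qmin; rewrite // /pr (subset_trans ZQ QP).
split.
  have [e ZQ ZnQ hf] := shrink V1 f; have hm := minZ _ ZQ ZnQ.
  have := leq_mul (leqnn a) hf; have := leq_mul (leqnn b) (subset_leq_card (imsetS g ZQ)).
  by rewrite mulnS; natlia.
have [e ZQ ZnQ hf] := shrink V2 g; have hm := minZ _ ZQ ZnQ.
have := leq_mul (leqnn b) hf; have := leq_mul (leqnn a) (subset_leq_card (imsetS f ZQ)).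
by rewrite mulnS; natlia.
Qed.

(* The Halmos-Vaughan induction: split along a tight set if there is one,
   otherwise assign one element arbitrarily. *)
Lemma hall_capacity (E V : finType) (v0 : V) (N : E -> {set V}) (D : {set E}) (cap : V -> nat) :
  (forall S : {set E}, S \subset D -> #|S| <= \sum_(y in \bigcup_(e in S) N e) cap y) ->
  exists p : E -> V, (forall e, e \in D -> p e \in N e) /\
                     (forall y, #|[set e in D | p e == y]| <= cap y).
Proof.
have [n] := ubnP #|D|; elim: n D N cap => // n IH D N cap /ltnSE hn hall.
have [->|D0] := eqVneq D set0.
  exists (fun=> v0); split=> [e|y]; rewrite ?inE // eq_card0 // => e.
  by rewrite !inE.
pose NN (S : {set E}) := \bigcup_(e in S) N e.
have [/existsP[S /and4P[SD S0 SnD /eqP tight]]|/existsPn slack] := boolP [exists S : {set E},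
    [&& S \subset D, S != set0, S != D & #|S| == \sum_(y in NN S) cap y]].
  have SD' : S \proper D by rewrite properEneq SnD.
  have [||p1 [p1N p1c]] := IH S N cap.
  - exact: leq_trans (proper_card SD') hn.
  - by move=> S' S'S; apply: hall; apply: subset_trans SD.
  have [||p2 [p2N p2c]] := IH (D :\: S) (fun e => N e :\: NN S) cap.
  - apply: leq_trans hn; apply/proper_card; rewrite properEneq subsetDl andbT.
    have [x xS] := set0Pn _ S0; apply: contraTneq (subsetP SD _ xS) => <-.
    by rewrite inE xS.
  (* Subtracting the equality at the tight set [S] from the condition at [S :|: S'] leaves the
     condition at [S'] with the neighbours of [S] removed. *)
  - move=> S' S'D; have SS' : S :|: S' \subset D.
      by rewrite subUset SD (subset_trans S'D (subsetDl _ _)).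
    have := hall _ SS'; rewrite -/(NN _).
    have -> : #|S :|: S'| = #|S| + #|S'|.
      rewrite cardsU; suff -> : S :&: S' = set0 by rewrite cards0 subn0.
      apply/setP=> x; rewrite !inE; apply/andP=> -[xS /(subsetP S'D)].
      by rewrite inE xS.
    rewrite (bigID (mem (NN S))) /= tight => h; rewrite -(leq_add2l (\sum_(y in NN S) cap y)).
    apply: leq_trans h _; apply: leq_add.
      rewrite [X in _ <= X](bigID (mem (NN (S :|: S')))) /= -[X in X <= _]addn0 leq_add //.
      by under eq_bigl do rewrite andbC.
    rewrite [X in _ <= X](bigID (mem (NN (S :|: S')))) /= -[X in X <= _]addn0 leq_add //.
    rewrite leq_eqVlt; apply/orP; left; apply/eqP/eq_bigl => y; apply/andP/andP.
      case=> /bigcupP[e /setUP[eS|eS'] ye] yS.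
        by case/negP: yS; apply/bigcupP; exists e.
      split; apply/bigcupP; exists e => //; first by rewrite inE ye andbT.
      by rewrite inE eS' orbT.
    by case=> /bigcupP[e eS' /setDP[ye yS]] yU.
  exists (fun e => if e \in S then p1 e else p2 e); split=> [e eD|y].
    case: ifP => eS; first exact: p1N.
    by have /setDP[] : p2 e \in N e :\: NN S by apply: p2N; rewrite inE eS.
  have [yS|yS] := boolP (y \in NN S).
    apply: leq_trans (p1c y); apply/subset_leq_card/subsetP=> e; rewrite !inE.
    case/andP=> eD; case: ifP => // eS /eqP e2.
    by have := p2N e; rewrite !inE eS eD e2 yS => /(_ isT).
  apply: leq_trans (p2c y); apply/subset_leq_card/subsetP=> e; rewrite !inE.
  case/andP=> eD; case: ifP => [eS /eqP e1|eS ->]; last by rewrite eD.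
  by case/negP: yS; apply/bigcupP; exists e => //; rewrite -e1 p1N.
have [e0 e0D] := set0Pn _ D0.
have [y0 y0N cap0] : exists2 y, y \in N e0 & 0 < cap y.
  have := hall [set e0]; rewrite sub1set e0D cards1 big_set1 => /(_ isT).
  rewrite lt0n sum_nat_eq0 => /forall_inPn[y yN].
  by rewrite -lt0n => h; exists y.
have [||p [pN pc]] := IH (D :\ e0) N (fun y => cap y - (y == y0)).
- by move: hn; rewrite (cardsD1 e0) e0D.
(* A set that is not tight has a unit to spare, which covers the unit of capacity taken from
   [y0]. *)
- move=> S SD; have [->|S0] := eqVneq S set0; first by rewrite cards0.
  have SD' : S \subset D by apply: subset_trans SD (subsetDl _ _).
  have SnD : S != D by apply: contraTneq e0D => <-; apply/negP=> /(subsetP SD); rewrite !inE eqxx.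
  have := slack S; rewrite SD' S0 SnD /= => ns.
  have := hall S SD'; rewrite leq_eqVlt (negPf ns) /= -/(NN S) => h.
  rewrite -ltnS; apply: leq_trans h _; rewrite -addn1.
  have c1 : \sum_(y in NN S) (y == y0) <= 1.
    by rewrite -big_mkcondr /= sum1_card; apply: leq_trans (subset_leq_card _) (_ : #|pred1 y0| <= 1);
      [apply/subsetP=> y; rewrite !inE => /andP[] | rewrite card1].
  apply: leq_trans (leq_add (leqnn _) c1); rewrite -big_split /=.
  by apply: leq_sum => y _; natlia.
exists (fun e => if e == e0 then y0 else p e); split=> [e eD|y].
  by case: eqP => [->//|/eqP ee]; apply: pN; rewrite !inE ee.
have -> : #|[set e in D | (if e == e0 then y0 else p e) == y]| =
    (y == y0) + #|[set e in D :\ e0 | p e == y]|.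
  rewrite (cardsD1 e0) !inE e0D eqxx /= (eq_sym y0); congr (_ + _).
  by apply: eq_card => e; rewrite !inE; case: (e == e0).
by have := pc y; case: eqP => [->|_]; natlia.
Qed.

(** * Induced subgraphs and cutvertices *)

Lemma induced_adj (G : sgraph) (S : {set G}) (x y : induced S) :
  adj x y = adj (val x) (val y).
Proof.
rewrite /= /sub_adj inE in_edges; case: adj => //=.
by rewrite subUset !sub1set; apply/andP; split; [exact: (valP x) | exact: (valP y)].
Qed.

Lemma nverts_induced (G : sgraph) (S : {set G}) : nverts (induced S) = #|S|.
Proof. by rewrite /nverts cardsT card_sig; apply: eq_card => x. Qed.

Lemma connect_map (T T' : finType) (e : rel T) (e' : rel T') (h : T -> T') x y :
  (forall a b, e a b -> e' (h a) (h b)) -> connect e x y -> connect e' (h x) (h y).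
Proof.
move=> eh /connectP[p]; elim: p x => [|b p IH] x /=; first by move=> _ ->; apply: connect0.
by case/andP=> /eh xb hp hy; apply: connect_trans (connect1 xb) (IH _ hp hy).
Qed.

(** Sending each component of the graph without [v] to the component of [H] around it is onto, since
    the component of [v] also contains [w]. It is not injective, because the components of [w] and
    [a] are merged. *)
Lemma separates_cutvertex (H : sgraph) (v w a : H) :
  adj v w -> adj v a ->
  (forall w' a' : induced [set~ v], val w' = w -> val a' = a ->
     ~~ connect (@adj (induced [set~ v])) w' a') ->
  cutvertex v.
Proof.
move=> vw va sep; pose Hv := induced [set~ v].
pose cl (F : sgraph) (x : F) := [set y | connect (@adj F) x y].
have clE (F : sgraph) (x y : F) : connect (@adj F) x y -> cl F x = cl F y.
  move=> xy; apply/setP=> z; rewrite !inE.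
  exact: (same_connect (sym_connect_sym (@adj_sym F)) xy z).
have inv x (xv : x != v) : x \in [set~ v] by rewrite !inE.
pose g (X : {set Hv}) := if [pick x in X] is Some x then cl H (val x) else set0.
have gE (x : Hv) : g (cl Hv x) = cl H (val x).
  rewrite /g; case: pickP => [y|/(_ x)]; last by rewrite inE connect0.
  rewrite inE => xy; apply/esym/clE.
  by apply: connect_map xy => b c; rewrite induced_adj.
have wv : w != v by apply: contraTneq vw => ->; rewrite adj_irrefl.
have av : a != v by apply: contraTneq va => ->; rewrite adj_irrefl.
pose w' : Hv := Sub w (inv w wv); pose a' : Hv := Sub a (inv a av).
have compE (F : sgraph) : components F = [set cl F x | x in [set: F]] by [].
have sub : components H \subset g @: components Hv.
  apply/subsetP=> _ /imsetP[x _ ->]; rewrite -/(cl H x).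
  have [->|xv] := eqVneq x v.
    rewrite (clE _ _ _ (connect1 vw)); apply/imsetP; exists (cl Hv w'); first exact: imset_f.
    by rewrite gE.
  apply/imsetP; exists (cl Hv (Sub x (inv x xv))); first exact: imset_f.
  by rewrite gE.
have le := leq_imset_card g (components Hv).
rewrite /cutvertex ltn_neqAle (leq_trans (subset_leq_card sub) le) andbT.
apply/negP=> /eqP e.
have /imset_injP inj : #|g @: components Hv| == #|components Hv|.
  by rewrite eqn_leq le -e subset_leq_card.
have := sep w' a' erefl erefl; have -> : connect (@adj Hv) w' a'; last by [].
have : cl Hv w' = cl Hv a'.
  apply: inj; try exact: imset_f.
  by rewrite !gE -(clE _ _ _ (connect1 vw)) -(clE _ _ _ (connect1 va)).
by move/setP/(_ a'); rewrite !inE connect0.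
Qed.

(** * Cliques of low vertices in a list-critical graph *)

Lemma card_nbrT (G : sgraph) (v : G) : deg v = #|nbr setT v|.
Proof. by apply: eq_card => u; rewrite !inE. Qed.

Lemma is_KP (H : sgraph) n (A : {set H}) : reflect (#|A| = n /\ clique A) (is_K n A).
Proof.
apply: (iffP andP) => [[/eqP cA /forall_inP h]|[cA h]]; split=> //.
- move=> x y xA yA xy; have /forall_inP/(_ y yA)/implyP := h x xA; exact.
- exact/eqP.
- by apply/forall_inP=> x xA; apply/forall_inP=> y yA; apply/implyP; apply: h.
Qed.

Section Critical.
Variables (G : sgraph) (m : nat).
Hypotheses (m_ge4 : 4 <= m) (hcrit : list_critical m.+1 G) (hG : ~~ complete G).
Implicit Types (S X Y D A : {set G}) (u v w x y z : G).

Lemma induced_coloring S (C : finType) (c0 : C) (L : G -> {set C}) :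
  S != setT -> (forall v, m <= #|L v|) -> colorable S L.
Proof.
move=> SnT hL; have [_ /(_ (induced S))] := hcrit.
rewrite /proper_subgraph /= SnT => /(_ isT C (fun x : induced S => L (val x))) [] => [v|f [fL fP]].
  exact: hL.
pose g x := if insub x is Some s then f s else c0.
have gE x (xS : x \in S) : g x = f (Sub x xS) by rewrite /g insubT.
exists g; split=> [x xS|x y xS yS xy]; first by rewrite gE; apply: (fL (Sub x xS)).
by rewrite !gE; apply: fP; rewrite induced_adj.
Qed.

(** Colour the complement of [S] by criticality. A vertex of [S] loses at most one colour per
    neighbour outside [S], which leaves lists of the size assumed here; the inequality is additive
    to avoid truncated subtraction. *)
Lemma critical_not_colorable S : S != set0 ->
  (forall (C : finType) (c0 : C) (L : G -> {set C}),
     (forall v, v \in S -> m + #|nbr S v| <= #|L v| + deg v) -> colorable S L) ->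
  False.
Proof.
move=> /set0Pn[s0 s0S] h; case: hcrit => nch _; apply: nch => /= C L hL.
have [c0 _] : exists c0, c0 \in L s0 by apply/card_gt0P; have := hL s0; natlia.
have [|f [fL fP]] := @induced_coloring (~: S) C c0 L _ hL.
  by apply/eqP=> /setP/(_ s0); rewrite !inE s0S.
have [v vS|g [gL gP]] := h C c0 (fun v => L v :\: (f @: nbr (~: S) v)).
  have e : deg v = #|nbr S v| + #|nbr (~: S) v|.
    rewrite card_nbrT -(cardsID S); congr (_ + _); apply: eq_card => t.
      by rewrite !inE /= andbC.
    by rewrite !inE.
  have := hL v; have := leq_imset_card f (nbr (~: S) v).
  have := cardsID (f @: nbr (~: S) v) (L v).
  have := subset_leq_card (subsetIr (L v) (f @: nbr (~: S) v)); natlia.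
have fg x y : x \in S -> y \notin S -> adj x y -> g x != f y.
  move=> xS yS xy; have /setDP[_] := gL x xS; apply: contraNneq => ->.
  by apply: imset_f; rewrite !inE yS.
exists (fun x => if x \in S then g x else f x); split=> [v|u v uv].
  by case: ifP => [/gL/setDP[]//|vS]; apply: fL; rewrite inE vS.
case: ifP => uS; case: ifP => vS.
- exact: gP.
- by apply: fg; rewrite ?vS.
- by rewrite eq_sym; apply: fg; rewrite ?uS // adj_sym.
- by apply: fP; rewrite ?inE ?uS ?vS.
Qed.

(** If [A] is everything, [G] is complete; otherwise criticality would colour [A] from [m] common
    colours. *)
Lemma no_big_clique A : clique A -> #|A| = m.+1 -> False.
Proof.
move=> cA hA; have [AT|AnT] := eqVneq A setT.
  case/negP: hG; apply/forallP=> x; apply/forallP=> y; apply/implyP=> xy.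
  by apply: cA; rewrite ?AT.
have c0 : 'I_m by exists 0; natlia.
have [|f [_ fP]] := @induced_coloring A 'I_m c0 (fun=> setT) AnT.
  by move=> _; rewrite cardsT card_ord.
have : #|A| <= #|'I_m|.
  rewrite -(@card_in_imset _ _ f A) ?max_card // => x y xA yA e.
  apply/eqP/negPn/negP=> xy; have := fP x y xA yA (cA x y xA yA xy).
  by rewrite e eqxx.
by rewrite card_ord hA ltnn.
Qed.

Lemma deg_ge v : m <= deg v.
Proof.
rewrite leqNgt; apply/negP=> hv; apply: (@critical_not_colorable [set v]).
  by apply/set0Pn; exists v; rewrite set11.
move=> C c0 L hL; apply: (@conn_colorable _ _ c0 _ L v (conn1 v)) => [x /set1P->||].
- have := hL v (set11 v); natlia.
- exact: set11.
- have := hL v (set11 v); natlia.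
Qed.

Definition low := [set v : G | deg v == m].

Lemma low_deg v : v \in low -> deg v = m.
Proof. by rewrite inE => /eqP. Qed.

Definition lowK A := (A \subset low) && is_K m A.

Lemma lowKP A : reflect [/\ A \subset low, #|A| = m & clique A] (lowK A).
Proof. by apply: (iffP andP) => [[? /is_KP[]]|[? ? ?]]; split=> //; apply/is_KP. Qed.

Definition attach A X := [set a in A | [exists x in X, adj a x]].

Lemma attachP A X a : reflect (a \in A /\ exists2 x, x \in X & adj a x) (a \in attach A X).
Proof. by rewrite inE; apply: (iffP andP) => -[aA /exists_inP]. Qed.

(* A vertex [v] of [A] with a neighbour in [X] has a longer list than a vertex
   [u] of [A] without one, and [v] is not a cutvertex of [A :|: X]. *)
Lemma attach_proper A X : lowK A -> X \subset low :\: A -> conn X ->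
  1 < #|attach A X| -> #|attach A X| = m.
Proof.
case/lowKP=> Al cA kA Xl cX att; apply/eqP; rewrite eqn_leq.
have attA : attach A X \subset A by apply/subsetP=> a /attachP[].
rewrite -{1}cA subset_leq_card //= leqNgt; apply/negP=> attm.
have XA x : x \in X -> x \notin A by move=> /(subsetP Xl) /setDP[].
have [u uA uX] : exists2 u, u \in A & u \notin attach A X.
  by apply/subsetPn; apply: contraTN attm => /subset_leq_card; rewrite cA -leqNgt.
have [v vatt] : exists v, v \in attach A X by apply/card_gt0P; natlia.
have [v' v'att vv'] : exists2 v', v' \in attach A X & v' != v.
  have /card_gt0P[v' /setD1P[]] : 0 < #|attach A X :\ v|; last by exists v'.
  by rewrite (cardsD1 v) vatt in att.
have /attachP[vA [x xX vx]] := vatt; have /attachP[v'A [x' x'X vx']] := v'att.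
have uv : u != v by apply: contraNneq uX => ->.
have Hl : A :|: X \subset low by rewrite subUset Al (subset_trans Xl (subsetDl _ _)).
apply: (@critical_not_colorable (A :|: X)).
  by apply/set0Pn; exists v; rewrite inE vA.
move=> C c0 L hL0.
have hL t : t \in A :|: X -> #|nbr (A :|: X) t| <= #|L t|.
  move=> tH; have := hL0 t tH.
  by rewrite (low_deg (subsetP Hl _ tH)) addnC leq_add2r.
have cH : conn (A :|: X) by apply: conn_setU vx => //; exact: conn_clique.
have [vH uH] : v \in A :|: X /\ u \in A :|: X by rewrite !inE vA uA.
have du : #|nbr (A :|: X) u| = m.-1.
  rewrite -cA; apply: card_nbr_clique => //; first exact: subsetUl.
  apply/subsetP=> t; rewrite in_nbr => /andP[/setUP[//|tX] ut].
  by case/negP: uX; apply/attachP; split=> //; exists t.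
have dv : m <= #|nbr (A :|: X) v|.
  have : x |: A :\ v \subset nbr (A :|: X) v.
    apply/subsetP=> t /setU1P[->|/setD1P[tv tA]]; rewrite !inE ?xX ?orbT //.
    by rewrite tA kA // eq_sym.
  move/subset_leq_card; rewrite cardsU1 !inE (negPf (XA _ xX)) andbF.
  by have := cardsD1 v A; rewrite vA cA; natlia.
(* A spare colour makes [u] a root. Otherwise [L u] has at most m - 1 colours and [L v] at least m,
   so [v] has a colour that [u] lacks. *)
have [Lu|Lu] := ltnP #|nbr (A :|: X) u| #|L u|; first exact: (conn_colorable c0 cH hL uH).
have [a aLv aLu] : exists2 a, a \in L v & a \notin L u.
  apply/subsetPn/negP=> /subset_leq_card; have := hL v vH; natlia.
apply: (@noncut_colorable _ _ c0 _ _ u v a) => //; last by apply: kA; rewrite // eq_sym.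
(* The second attachment [v'] still joins the rest of the clique to [X]. *)
have -> : (A :|: X) :\ v = (A :\ v) :|: X.
  apply/setP=> t; rewrite !inE; case: eqVneq => //= ->.
  by apply/esym/negbTE; apply: contraTN vA; exact: XA.
apply: conn_setU (cX) _ x'X vx'; last by rewrite !inE vv'.
by apply/conn_clique/(cliqueS kA)/subsetDl.
Qed.

(** Two neighbours would force all of [A] to be adjacent to [z], giving a clique on m + 1
    vertices. *)
Lemma nbr_clique_le1 A z : lowK A -> z \in low :\: A -> #|nbr A z| <= 1.
Proof.
move=> KA zl; have /lowKP[Al cA kA] := KA; rewrite leqNgt; apply/negP=> h.
have nE : nbr A z = attach A [set z].
  apply/setP=> t; rewrite in_nbr; apply/andP/attachP => [[tA zt]|[tA [? /set1P-> tz]]].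
    by split=> //; exists z; rewrite ?set11 // adj_sym.
  by rewrite tA adj_sym.
have := attach_proper KA _ (conn1 z); rewrite -nE sub1set => /(_ zl h) hm.
have nA : nbr A z = A by apply/eqP; rewrite eqEcard nbr_sub hm cA leqnn.
have zA t : t \in A -> adj z t by rewrite -nA in_nbr => /andP[].
apply: (@no_big_clique (z |: A)); last first.
  by rewrite cardsU1 cA; case/setDP: zl => _ ->.
move=> s t /setU1P[->|sA] /setU1P[->|tA] st; first by rewrite eqxx in st.
- exact: zA.
- by rewrite adj_sym zA.
- exact: kA.
Qed.

(** Grow a connected part of [X] as long as it has at most one attachment. The next vertex adds at
    most one more, giving two, while [attach_proper] demands m. *)
Lemma attach_le1 A X : lowK A -> X \subset low :\: A -> conn X -> #|attach A X| <= 1.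
Proof.
move=> KA Xl cX; rewrite leqNgt; apply/negP=> att.
have [x0 x0X] : exists x, x \in X.
  have /card_gt0P[a /attachP[_ [x xX _]]] : 0 < #|attach A X| by natlia.
  by exists x.
have att1 z : z \in X -> #|attach A [set z]| <= 1.
  move=> zX; apply: leq_trans (nbr_clique_le1 KA (subsetP Xl _ zX)).
  apply/subset_leq_card/subsetP=> t /attachP[tA [? /set1P-> tz]].
  by rewrite in_nbr tA adj_sym.
pose pr (Z : {set G}) := [&& Z \subset X, conn Z & #|attach A Z| <= 1].
have [|Z /maxsetP[/and3P[ZX cZ attZ] Zmax] x0Z] := @maxset_exists _ pr [set x0].
  by rewrite /pr sub1set x0X conn1 att1.
have x0Z' : x0 \in Z by apply: (subsetP x0Z); rewrite set11.
have /connP/(_ Z ZX) := cX => -[||x [z [xZ zX zZ xz]]].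
- by apply/set0Pn; exists x0.
- by apply: contraTneq attZ => ->; rewrite -ltnNge.
have zZX : z |: Z \subset X by rewrite subUset sub1set zX.
have cz : conn (z |: Z) by apply: conn_setU1 xz.
have big : 1 < #|attach A (z |: Z)|.
  rewrite ltnNge; apply: contraNN zZ => h.
  by rewrite -(Zmax (z |: Z)) ?setU11 ?subsetUr // /pr zZX cz.
have := attach_proper KA (subset_trans zZX Xl) cz big.
have : attach A (z |: Z) \subset attach A [set z] :|: attach A Z.
  apply/subsetP=> t /attachP[tA [s /setU1P[->|sZ] ts]]; apply/setUP.
    by left; apply/attachP; split=> //; exists z; rewrite ?set11.
  by right; apply/attachP; split=> //; exists s.
move/subset_leq_card; rewrite cardsU; have := att1 z zX; natlia.
Qed.

(** If the branch entered through [vw] came back to [A], it would do so at a vertex other than [v],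
    and one component of [low :\: A] would attach to [A] twice. *)
Lemma branch_disjoint S A v w : lowK A -> S \subset low -> v \in A ->
  w \in S :\: A -> adj v w -> [disjoint component (S :\ v) w & A].
Proof.
move=> KA Sl vA /setDP[wS wA] vw.
have wl : w \in low :\: A by rewrite inE wA (subsetP Sl).
have wSv : w \in S :\ v by rewrite !inE wS andbT; apply: contraNneq wA => ->.
suff sub : component (S :\ v) w \subset component (low :\: A) w.
  rewrite disjoint_subset; apply: (subset_trans sub); apply: (subset_trans (component_sub wl)).
  by apply/subsetP=> t /setDP[].
apply/negPn/negP=> nsub; have /connP := component_conn wSv.
case/(_ (component (S :\ v) w :&: component (low :\: A) w)) => [|||x [y [/setIP[_ xD] yD nyD xy]]].
- exact: subsetIl.
- by apply/set0Pn; exists w; rewrite inE !component_id.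
- by apply: contraNN nsub => /eqP/setIidPl.
have /setD1P[yv yS] := subsetP (component_sub wSv) _ yD.
rewrite inE yD /= in nyD; have [yA|yA] := boolP (y \in A); last first.
  by case/negP: nyD; apply: (component_closed wl xD) => //; rewrite inE yA (subsetP Sl).
have := attach_le1 KA (component_sub wl) (component_conn wl); rewrite leqNgt => /negP; apply.
apply/card_gt1P; exists v, y; split; last by rewrite eq_sym.
  by apply/attachP; split=> //; exists w; rewrite ?component_id.
by apply/attachP; split=> //; exists x; rewrite // adj_sym.
Qed.

(** Distinct cliques meet in [z] alone by [nbr_clique_le1], so [z] would have 2(m - 1) > m
    neighbours. *)
Lemma lowK_inj A A' z : lowK A -> lowK A' -> z \in A -> z \in A' -> A = A'.
Proof.
move=> KA KA' zA zA'; have /lowKP[Al cA kA] := KA; have /lowKP[Al' cA' kA'] := KA'.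
apply/eqP; rewrite eq_sym eqEcard cA cA' leqnn andbT; apply/negPn/negP=> /subsetPn[w wA' wA].
have I1 : A :&: A' = [set z].
  apply/eqP; rewrite eq_sym eqEcard sub1set inE zA zA' cards1.
  apply: leq_trans (nbr_clique_le1 KA (_ : w \in _)); last by rewrite inE wA (subsetP Al').
  apply/subset_leq_card/subsetP=> t /setIP[tA tA']; rewrite in_nbr tA /= kA' //.
  by apply: contraNneq wA => ->.
have : (A :|: A') :\ z \subset nbr setT z.
  apply/subsetP=> t; rewrite !inE => /andP[tz /orP[tA|tA]].
    by apply: kA; rewrite // eq_sym.
  by apply: kA'; rewrite // eq_sym.
move/subset_leq_card; rewrite -card_nbrT (low_deg (subsetP Al _ zA)).
have := cardsD1 z (A :|: A'); rewrite inE zA /= => e.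
have := cardsU A A'; rewrite I1 cards1 cA cA'; natlia.
Qed.

(** With three neighbours in [A], [x] keeps two colours. One of them can be used so that a neighbour
    [v] and a non-neighbour [u] of [x] in [A] do not end up with equal short lists, and then [A] can
    be coloured. *)
Lemma high_nbr_clique_le2 A x : lowK A -> deg x = m.+1 -> #|nbr A x| <= 2.
Proof.
move=> KA dx; have /lowKP[Al cA kA] := KA; rewrite leqNgt; apply/negP=> h.
have xA : x \notin A by apply/negP=> /(subsetP Al)/low_deg; natlia.
have [u uA xu] : exists2 u, u \in A & ~~ adj x u.
  have [/subsetPn[u uA]|/negbNE/subsetP sub] := boolP (~~ (A \subset nbr A x)).
    by rewrite in_nbr uA; exists u.
  case: (@no_big_clique (x |: A)); last by rewrite cardsU1 cA xA.
  have zA t : t \in A -> adj x t by move/sub; rewrite in_nbr => /andP[].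
  move=> s t /setU1P[->|sA] /setU1P[->|tA] st; first by rewrite eqxx in st.
  - exact: zA.
  - by rewrite adj_sym zA.
  - exact: kA.
have [v] : exists v, v \in nbr A x by apply/card_gt0P; natlia.
rewrite in_nbr => /andP[vA xv].
apply: (@critical_not_colorable (x |: A)).
  by apply/set0Pn; exists x; rewrite setU11.
move=> C c0 L hL.
have nx : nbr (x |: A) x = nbr A x.
  by apply/setP=> t; rewrite !in_nbr in_setU1; case: (eqVneq t x) => [->|//]; rewrite adj_irrefl !andbF.
have Lx : 1 < #|L x| by have := hL x (setU11 _ _); rewrite nx dx; natlia.
have [g gLx gP] : exists2 g, g \in L x & L v :\: L u != [set g].
  have /card_gt1P[g [g' [gL gL' gg]]] := Lx.
  have [e|e] := eqVneq (L v :\: L u) [set g]; last by exists g.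
  by exists g' => //; rewrite e; apply: contraNneq gg => /set1_inj->.
have [|t tA||||||||f [fL fP]] := @clique_colorable G C c0 A A (fun t => if adj x t then L t :\ g else L t) u v.
- exact: conn_clique.
- have := hL t (setU1r _ tA); rewrite (low_deg (subsetP Al _ tA)).
  have : #|nbr (x |: A) t| = adj x t + #|nbr A t|.
    rewrite (cardsD1 x) in_nbr setU11 /= adj_sym; congr (_ + _).
    by apply: eq_card => s; rewrite !inE; case: (eqVneq s x) => [->|//]; rewrite (negPf xA).
  by case: adj => ->; [have := cardsD1 g (L t); case: (g \in L t) |]; natlia.
- exact: kA.
- exact: subxx.
- exact: uA.
- exact: vA.
- exact: nbr_sub.
- exact: nbr_sub.
(* If the lists agree, the choice of [g] implies that [g] was not in [L v], so [v] still has m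
   colours. *)
- rewrite (negPf xu) xv; have [e|] := eqVneq (L u) (L v :\ g); [right|by left].
  have Lv : m <= #|L v|.
    have := hL v (setU1r _ vA); rewrite (low_deg (subsetP Al _ vA)).
    have : x |: A :\ v \subset nbr (x |: A) v.
      apply/subsetP=> t; rewrite !inE => /predU1P[->|/andP[tv tA]].
        by rewrite eqxx adj_sym.
      by rewrite tA orbT kA // eq_sym.
    move/subset_leq_card; rewrite cardsU1 !inE (negPf xA) andbF.
    by have := cardsD1 v A; rewrite vA cA; natlia.
  rewrite cA leqNgt; apply/negP=> h'; case/eqP: gP; rewrite e.
  have gv : g \in L v by have := cardsD1 g (L v); case: (g \in L v) => //; natlia.
  by apply/setP=> t; rewrite !inE; case: eqVneq => [->|]; rewrite ?gv ?andNb.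
have g_neq t : t \in A -> adj x t -> g != f t.
  by move=> tA xt; have := fL t tA; rewrite xt => /setD1P[]; rewrite eq_sym.
exists (fun z => if z == x then g else f z); split=> [t /setU1P[->|tA]|y z].
- by rewrite eqxx.
- case: eqP => [->//|_]; have := fL t tA; case: ifP => // _.
  by case/setD1P.
move=> /setU1P[->|yA] /setU1P[->|zA]; rewrite ?adj_irrefl ?eqxx // => yz.
- by case: (eqVneq z x) => [zx|_]; [rewrite -zx zA in xA | exact: g_neq].
- case: (eqVneq y x) => [yx|_]; first by rewrite -yx yA in xA.
  by rewrite eq_sym; apply: g_neq; rewrite // adj_sym.
- case: (eqVneq y x) => [yx|_]; first by rewrite -yx yA in xA.
  by case: (eqVneq z x) => [zx|_]; [rewrite -zx zA in xA | exact: fP].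
Qed.

(** * Colouring the high vertices first *)

Definition rank (x : G) : nat := enum_rank x.

(** Choose in order of rank. [forb y] takes a total function but looks only at values of smaller
    rank, so later choices do not change it. *)
Lemma sequential_choice (C : finType) (c0 : C) Y (L : G -> {set C})
    (forb : G -> (G -> C) -> {set C}) :
  (forall y f g, y \in Y -> (forall z, z \in Y -> rank z < rank y -> f z = g z) ->
     forb y f = forb y g) ->
  (forall y f, y \in Y -> #|forb y f| < #|L y|) ->
  exists f : G -> C, forall y, y \in Y -> f y \in L y /\ f y \notin forb y f.
Proof.
move=> loc small.
suff H n : exists f : G -> C, forall y, y \in Y -> rank y < n -> f y \in L y /\ f y \notin forb y f.
  have [f fP] := H #|G|; exists f => y yY; apply: fP => //; exact: ltn_ord.
elim: n => [|n [f fP]]; first by exists (fun=> c0).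
have [y0 /andP[y0Y /eqP ry]|no] := pickP [pred y | (y \in Y) && (rank y == n)]; last first.
  exists f => y yY; rewrite ltnS leq_eqVlt; have := no y; rewrite /= yY /= => -> /=.
  exact: fP.
have : 0 < #|L y0 :\: forb y0 f|.
  rewrite cardsD subn_gt0; apply: leq_ltn_trans (small y0 f y0Y).
  exact/subset_leq_card/subsetIr.
case/card_gt0P=> c /setDP[cL cf].
exists (fun z => if z == y0 then c else f z) => y yY; rewrite ltnS leq_eqVlt => hy.
have -> : forb y (fun z => if z == y0 then c else f z) = forb y f.
  apply: loc => // z zY zy; case: eqP => // ze.
  by move: hy zy; rewrite ze ry => /orP[/eqP->|]; natlia.
case: (eqVneq y y0) => [->//|yy0]; apply: fP => //.
case/orP: hy => // /eqP hy; case/eqP: yy0; apply: enum_rank_inj; apply: ord_inj.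
by move: hy ry; rewrite /rank => -> ->.
Qed.

(* The vertices of [Y] are coloured in order of rank.  Uncolourability of
   [S T] would force the lists left at [vv T] and [uu T] to agree, and the one
   left at [uu T] is already known when [p T] is coloured, so avoiding this
   costs [p T] at most one colour. *)
Lemma payers_contradiction (I : finType) Y (D : {set I}) (S AA : I -> {set G}) (p vv uu : I -> G) :
  Y != set0 -> (forall y, y \in Y -> deg y = m.+1) ->
  (forall T, T \in D -> S T \subset low /\ conn (S T)) ->
  (forall T T' x y, T \in D -> T' \in D -> x \in S T -> y \in S T' -> adj x y -> T = T') ->
  (forall T, T \in D -> lowK (AA T) /\ AA T \subset S T) ->
  (forall T, T \in D -> [/\ uu T \in AA T, nbr (S T) (uu T) \subset AA T,
                            vv T \in AA T & nbr (S T) (vv T) \subset AA T]) ->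
  (forall T, T \in D -> [/\ p T \in Y, adj (vv T) (p T) &
     forall y, y \in Y -> adj (uu T) y -> rank y < rank (p T)]) ->
  (forall y, y \in Y ->
     #|[set T in D | p T == y]| + 2 <= #|nbr (\bigcup_(T in D) S T) y|) ->
  False.
Proof.
move=> Y0 degY SP Snadj AP uvP pP capY.
pose U := \bigcup_(T in D) S T.
have Ulow : U \subset low by apply/bigcupsP=> T /SP[].
have YnU y : y \in Y -> y \notin U.
  by move=> /degY dy; apply/negP=> /(subsetP Ulow) /low_deg; rewrite dy; natlia.
have nYU x : #|nbr (Y :|: U) x| = #|nbr Y x| + #|nbr U x|.
  rewrite -(cardsID Y); congr (_ + _); apply: eq_card => t; rewrite !inE.
    by case: (t \in Y); rewrite ?andbF ?andbT.
  by case: (boolP (t \in Y)) => //= /YnU/negPf ->.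
apply: (@critical_not_colorable (Y :|: U)).
  by have [y yY] := set0Pn _ Y0; apply/set0Pn; exists y; rewrite inE yY.
move=> C c0 L hL.
have hLy y : y \in Y -> #|nbr Y y| + #|nbr U y| <= #|L y| + 1.
  by move=> yY; have := hL y; rewrite inE yY (degY y yY) nYU => /(_ isT); natlia.
have hLu x : x \in U -> #|nbr Y x| + #|nbr U x| <= #|L x|.
  move=> xU; have := hL x; rewrite inE xU orbT (low_deg (subsetP Ulow _ xU)) nYU => /(_ isT).
  natlia.
pose R (f : G -> C) x := L x :\: (f @: nbr Y x).
(* Forbidden at [y] are the colours of its earlier neighbours in [Y] and, for each [T] charged to
   [y], the colour that would make the lists left at [vv T] and [uu T] agree. *)
pose forb y (f : G -> C) := (f @: [set z in Y | adj y z & rank z < rank y]) :|: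
  [set g | [exists T in D, (p T == y) && (L (vv T) :\: R f (uu T) == [set g])]].
have [||f fP] := @sequential_choice C c0 Y L forb.
- move=> y f g yY fg; congr (_ :|: _).
    by apply: eq_in_imset => z; rewrite inE => /and3P[zY _ zy]; apply: fg.
  apply/setP=> c; rewrite !inE; apply: eq_existsb => T.
  case TD: (T \in D) => //=; case: eqP => //= pT; rewrite /R.
  suff -> : f @: nbr Y (uu T) = g @: nbr Y (uu T) by [].
  apply: eq_in_imset => z; rewrite in_nbr => /andP[zY uz]; apply: fg => //.
  by have [_ _ h] := pP T TD; rewrite -pT; apply: h.
(* As [y] has degree m + 1, its list may be one smaller than its degree in [Y :|: U]. The slack of 2
   in [capY] covers this and the strict inequality. *)
- move=> y f yY; have := capY y yY; have := hLy y yY.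
  pose g0 T := odflt c0 [pick g | L (vv T) :\: R f (uu T) == [set g]].
  have h1 : #|f @: [set z in Y | adj y z & rank z < rank y]| <= #|nbr Y y|.
    apply: leq_trans (leq_imset_card _ _) _; apply/subset_leq_card/subsetP=> z.
    by rewrite !inE => /and3P[-> ->].
  have h2 : #|[set g | [exists T in D, (p T == y) && (L (vv T) :\: R f (uu T) == [set g])]]|
            <= #|[set T in D | p T == y]|.
    apply: leq_trans (leq_imset_card g0 _); apply/subset_leq_card/subsetP=> g.
    rewrite inE => /exists_inP[T TD /andP[pT /eqP e]]; apply/imsetP; exists T; first by rewrite inE TD.
    rewrite /g0; case: pickP => [g' /eqP|/(_ g)]; last by rewrite e eqxx.
    by rewrite e => /set1_inj.
  have [+ _] := leq_card_setU (f @: [set z in Y | adj y z & rank z < rank y])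
    [set g | [exists T in D, (p T == y) && (L (vv T) :\: R f (uu T) == [set g])]].
  rewrite -/(forb y f) -/U; natlia.
have colT T : T \in D -> colorable (S T) (R f).
  move=> TD; have [Sl cS] := SP T TD; have [KA AS] := AP T TD; have [uA nu vA nv] := uvP T TD.
  have [pY vp hu] := pP T TD; have /lowKP[Al cA kA] := KA.
  have SU : S T \subset U by apply: bigcup_sup.
  have vU : vv T \in U by apply: (subsetP SU); apply: (subsetP AS).
  apply: (@clique_colorable G C c0 (S T) (AA T) (R f) (uu T) (vv T)) => //.
    move=> x xS; have := hLu x (subsetP SU _ xS); have := subset_leq_card (nbrS x SU).
    have := leq_imset_card f (nbr Y x); have := cardsID (f @: nbr Y x) (L x).
    have := subset_leq_card (subsetIr (L x) (f @: nbr Y x)); rewrite /R; natlia.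
  (* The only neighbour of [vv T] in [Y] is [p T]. If the lists agree, either [f (p T)] was the
     forbidden colour, or it is not in [L (vv T)] and all m colours remain there. *)
  have [e|] := eqVneq (R f (uu T)) (R f (vv T)); [right|by left].
  have pA : p T \notin AA T.
    by apply: contra (YnU _ pY) => pA; apply: (subsetP SU); apply: (subsetP AS).
  have sub : p T |: AA T :\ vv T \subset nbr setT (vv T).
    apply/subsetP=> t /setU1P[->|/setD1P[tv tA]]; rewrite in_nbr inE //=.
    by apply: kA; rewrite // eq_sym.
  have csub : #|p T |: AA T :\ vv T| = m.
    rewrite cardsU1 !inE (negPf pA) andbF.
    by have := cardsD1 (vv T) (AA T); rewrite vA cA; natlia.
  have nT : nbr setT (vv T) = p T |: AA T :\ vv T.
    apply/esym/eqP; rewrite eqEcard sub csub -card_nbrT.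
    by rewrite (low_deg (subsetP Ulow _ vU)) leqnn.
  have nY : nbr Y (vv T) = [set p T].
    apply/setP=> t; rewrite in_nbr in_set1; apply/andP/eqP=> [[tY vt]|->//].
    have : t \in nbr setT (vv T) by rewrite in_nbr inE.
    rewrite nT => /setU1P[//|/setD1P[_ tA]].
    by case/negP: (YnU _ tY); apply: (subsetP SU); apply: (subsetP AS).
  have Lv : m <= #|L (vv T)|.
    apply: leq_trans (hLu _ vU); rewrite -nYU -csub; apply/subset_leq_card/subsetP=> t th.
    have := subsetP sub t th; rewrite !in_nbr inE /= => ->; rewrite andbT inE.
    case/setU1P: th => [->|/setD1P[_ tA]]; first by rewrite pY.
    by rewrite (subsetP SU) ?orbT // (subsetP AS).
  have RE : R f (vv T) = L (vv T) :\ f (p T) by rewrite /R nY imset_set1.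
  rewrite cA RE; have := cardsD1 (f (p T)) (L (vv T)).
  case fL : (f (p T) \in L (vv T)); last by natlia.
  have [_ /negP[]] := fP _ pY; rewrite inE; apply/orP; right; rewrite inE.
  apply/exists_inP; exists T => //; rewrite eqxx e RE /=; apply/eqP/setP=> t.
  by rewrite !inE; case: (eqVneq t (f (p T))) => [->|]; rewrite ?fL ?andNb.
have /fin_all_exists[g gP] T : exists g : G -> C, T \in D ->
  (forall x, x \in S T -> g x \in R f x) /\
  (forall x y, x \in S T -> y \in S T -> adj x y -> g x != g y).
  by case TD: (T \in D); [have [g gP] := colT T TD; exists g | exists (fun=> c0)].
pose h x := if [pick T in D | x \in S T] is Some T then g T x else f x.
have hY y : y \in Y -> h y = f y.
  move=> yY; rewrite /h; case: pickP => // T /andP[TD yS].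
  by case/negP: (YnU _ yY); apply/bigcupP; exists T.
have hU x : x \in U -> exists2 T, T \in D & x \in S T /\ h x = g T x.
  case/bigcupP=> T TD xS; rewrite /h; case: pickP => [T' /andP[T'D xS']|/(_ T)].
    by exists T'.
  by rewrite TD xS.
have hYU x y : x \in U -> y \in Y -> adj x y -> h x != h y.
  move=> /hU[T TD [xS ->]] yY xy; have [gR _] := gP T TD.
  have /setDP[_] := gR x xS; apply: contraNneq => ->; rewrite hY //.
  by apply: imset_f; rewrite in_nbr yY.
exists h; split=> [x /setUP[xY|xU]|x y /setUP[xY|xU] /setUP[yY|yU] xy].
- by rewrite hY //; case: (fP x xY).
- have [T TD [xS ->]] := hU x xU; have [gR _] := gP T TD.
  by have /setDP[] := gR x xS.
- rewrite !hY //.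
  have avoid a b : a \in Y -> b \in Y -> adj a b -> rank b < rank a -> f a != f b.
    move=> aY bY ab ba; have [_] := fP a aY; apply: contraNneq => ->.
    by rewrite inE imset_f // inE bY ab.
  case: (ltngtP (rank x) (rank y)) => [lt|lt|/ord_inj/enum_rank_inj e].
  + by rewrite eq_sym; apply: avoid; rewrite // adj_sym.
  + exact: avoid.
  + by rewrite e adj_irrefl in xy.
- by rewrite eq_sym; apply: hYU; rewrite // adj_sym.
- exact: hYU.
have [T TD [xS ->]] := hU x xU; have [T' T'D [yS ->]] := hU y yU.
have e := Snadj T T' x y TD T'D xS yS xy; rewrite -e in yS *; have [_ gN] := gP T TD.
exact: gN.
Qed.

(** * Components offer two chargeable edges *)

(** By [lowK_inj] at most one clique qualifies; [set0] is a default. *)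
Definition clq v := odflt set0 [pick A : {set G} | lowK A && (v \in A)].

(** For [v] in [qset] this is its unique neighbour outside [low], by [eta_eq] and [etaP]. *)
Definition eta v := odflt v [pick w | adj v w & w \notin low].

(** A local substitute for the vertices counted by [q]: instead of not being a cutvertex, [v] has no
    low neighbour outside its clique. *)
Definition qset := [set v : G | [exists A : {set G}, [&& lowK A, v \in A & nbr low v \subset A]]].

Lemma clqE A v : lowK A -> v \in A -> clq v = A.
Proof.
move=> KA vA; rewrite /clq; case: pickP => [A' /andP[KA' vA']|/(_ A)] /=.
  exact: lowK_inj vA' vA.
by rewrite KA vA.
Qed.

Lemma qsetP v : v \in qset -> [/\ lowK (clq v), v \in clq v & nbr low v \subset clq v].
Proof. by rewrite inE => /existsP[A /and3P[KA vA nA]]; rewrite (clqE KA vA). Qed.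

Lemma qset_low v : v \in qset -> v \in low.
Proof. by case/qsetP=> /lowKP[/subsetP Al _ _] /Al. Qed.

Lemma lowK_sub_nbr A v : lowK A -> v \in A -> A :\ v \subset nbr low v /\ #|A :\ v| = m.-1.
Proof.
case/lowKP=> Al cA kA vA; split; last by have := cardsD1 v A; rewrite vA cA; natlia.
apply/subsetP=> t /setD1P[tv tA]; rewrite in_nbr (subsetP Al) //.
by apply: kA; rewrite // eq_sym.
Qed.

Lemma nbr_low_split v : v \in low -> #|nbr low v| + #|nbr (~: low) v| = m.
Proof.
move=> vl; rewrite -(low_deg vl) card_nbrT -[RHS](cardsID low); congr (_ + _).
  by apply: eq_card => t; rewrite !inE andbC.
by apply: eq_card => t; rewrite !inE.
Qed.

(** The m - 1 neighbours in [A] together with [y] exhaust the degree of [v]. *)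
Lemma lowK_qset A v y : lowK A -> v \in A -> adj v y -> y \notin low -> v \in qset.
Proof.
move=> KA vA vy yl; rewrite inE; apply/existsP; exists A; rewrite KA vA /=.
have [sub cAv] := lowK_sub_nbr KA vA; have /lowKP[Al _ _] := KA.
have : A :\ v == nbr low v.
  rewrite eqEcard sub cAv /=; have := nbr_low_split (subsetP Al _ vA).
  have : 0 < #|nbr (~: low) v| by apply/card_gt0P; exists y; rewrite !inE in yl *; rewrite yl.
  natlia.
by move/eqP<-; apply: subsetDl.
Qed.

Lemma eta_eq v y : v \in qset -> adj v y -> y \notin low -> eta v = y.
Proof.
move=> vq vy yl; have [KA vA nA] := qsetP vq; have [sub cAv] := lowK_sub_nbr KA vA.
rewrite /eta; case: pickP => [w /andP[vw wl]|/(_ y)] /=; last by rewrite vy yl.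
have : #|nbr (~: low) v| <= 1.
  by have := nbr_low_split (qset_low vq); have := subset_leq_card sub; rewrite cAv; natlia.
by move/card_le1_eqP; apply; rewrite !inE in wl yl *; rewrite ?wl ?yl.
Qed.

Lemma etaP v : v \in qset -> adj v (eta v) /\ eta v \notin low.
Proof.
move=> vq; have [KA vA nA] := qsetP vq.
have [y] : exists y, y \in nbr (~: low) v.
  apply/card_gt0P; have := nbr_low_split (qset_low vq).
  have : nbr low v \subset clq v :\ v.
    apply/subsetP=> t tn; rewrite !inE (subsetP nA) // andbT.
    by apply: contraTneq tn => ->; rewrite in_nbr adj_irrefl andbF.
  by move/subset_leq_card; have [_ ->] := lowK_sub_nbr KA vA; natlia.
rewrite in_nbr inE => /andP[yl vy].
by rewrite (eta_eq vq vy yl).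
Qed.

(** * Good vertices of a pruned component *)

Section GoodVertices.
Variables Y S : {set G}.
Hypotheses (degY : forall y, y \in Y -> deg y = m.+1) (Sl : S \subset low) (cS : conn S).

Let R := [set v in qset | (v \in S) && (eta v \in Y)].

(** Then [r] and [u] can serve as [vv T] and [uu T] in [payers_contradiction], with [eta r] charged
    for the component. *)
Definition good r := (r \in R) &&
  [exists u in clq r, (nbr S u \subset clq r) &&
     [forall y in Y, adj u y ==> (rank y < rank (eta r))]].

Hypothesis clqS : forall r, r \in R -> clq r \subset S.
Hypothesis Smin : forall S' : {set G}, S' \subset S -> conn S' ->
  (forall r, r \in R -> clq r \subset S') -> S' = S.

Let Ylow y : y \in Y -> y \notin low.
Proof. by move=> yY; apply/negP=> /low_deg; rewrite degY //; natlia. Qed.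

Let RP r : r \in R -> [/\ r \in qset, r \in S & eta r \in Y].
Proof. by rewrite inE => /and3P. Qed.

Let nbrS_clq r : r \in qset -> nbr S r \subset clq r.
Proof. by case/qsetP=> _ _; apply: subset_trans; apply: nbrS. Qed.

Lemma not_good_inner r u : r \in R -> ~~ good r -> u \in clq r -> nbr S u \subset clq r ->
  [/\ u \in R, clq u = clq r & rank (eta r) <= rank (eta u)].
Proof.
move=> rR; rewrite /good rR /= => /exists_inPn h uA nu.
have [rq rS etY] := RP rR; have [KA rA nA] := qsetP rq.
have := h u uA; rewrite nu /= => /forall_inPn[y yY]; rewrite negb_imply -leqNgt => /andP[uy ry].
have uq := lowK_qset KA uA uy (Ylow yY); have e := eta_eq uq uy (Ylow yY).
by rewrite (clqE KA uA) inE uq e yY (subsetP (clqS rR)).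
Qed.

(** Since [r] is not good, [eta u] never precedes [eta r] for an inner [u]. At most two such [u]
    share the neighbour [eta r]; for the others [eta u] comes strictly later, so [r] itself
    witnesses that [u] is good. *)
Lemma good_inner_card r : r \in R -> ~~ good r ->
  #|[set u in clq r | nbr S u \subset clq r]| <=
  2 + #|[set u in clq r | (nbr S u \subset clq r) && good u]|.
Proof.
move=> rR ng; have [rq rS etY] := RP rR; have [KA rA nA] := qsetP rq.
apply: leq_trans (leq_add (high_nbr_clique_le2 KA (degY etY)) (leqnn _)).
apply: leq_trans (leq_card_setU _ _).1; apply/subset_leq_card/subsetP=> u.
rewrite inE => /andP[uA nu]; have [uR eA le] := not_good_inner rR ng uA nu.
have [uq uS euY] := RP uR; have [ue _] := etaP uq.
have [e|ne] := eqVneq (eta u) (eta r); first by rewrite !inE uA -e adj_sym ue.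
rewrite !inE uA nu; apply/orP; right; rewrite /good uR eA /=.
apply/exists_inP; exists r => //; rewrite nbrS_clq //=.
apply/forall_inP=> y yY; apply/implyP=> ry; rewrite -(eta_eq rq ry (Ylow yY)).
rewrite ltn_neqAle le andbT; apply: contra ne => /eqP e.
by rewrite eq_sym; apply/eqP/enum_rank_inj/ord_inj.
Qed.

(* By minimality of [S], a component of [S :\ o] hanging off a clique at [o]
   contains another clique; recurse away from [o]. *)
Lemma branch_good A o w : lowK A -> o \in A -> o \in S -> w \in S :\: A -> adj o w ->
  exists2 g, g \in component (S :\ o) w & good g.
Proof.
have [n] := ubnP #|component (S :\ o) w|; elim: n A o w => // n IH A o w /ltnSE hn KA oA oS wSA ow.
have /setDP[wS wA] := wSA; have wSo : w \in S :\ o.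
  by rewrite !inE wS andbT; apply: contraNneq wA => ->.
pose D := component (S :\ o) w; rewrite -/D in hn *.
have DS : D \subset S :\ o by apply: component_sub.
have cD : conn D by apply: component_conn.
have DA : [disjoint D & A] by apply: branch_disjoint.
have closed x y : x \in D -> y \in S -> y != o -> adj x y -> y \in D.
  by move=> xD yS yo xy; apply: (component_closed wSo xD) => //; rewrite !inE yo.
have wD : w \in D := component_id _ _.
have [r rR nsub] : exists2 r, r \in R & ~~ (clq r \subset S :\: D).
  have [/exists_inP[r rR h]|/exists_inPn h] := boolP [exists r in R, ~~ (clq r \subset S :\: D)].
    by exists r.
  (* [D] is joined to the rest of [S] only through [o], so removing it keeps [S] connected, and
     minimality applies. *)
  have e : S :\: D = S.
    apply: Smin; first exact: subsetDl; last by move=> r /h; rewrite negbK.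
    apply/connP=> X XS X0 XnS.
    have XD x : x \in X -> x \in S /\ x \notin D by move/(subsetP XS)/setDP.
    have [oX|oX] := boolP (o \in X).
      have /connP/(_ (X :|: D)) := cS; case=> [|||x [y [xX yS]]].
      - rewrite subUset (subset_trans XS (subsetDl _ _)) /=.
        exact: subset_trans DS (subsetDl _ _).
      - by apply/set0Pn; exists o; rewrite inE oX.
      - apply: contraNneq XnS => e; rewrite eqEsubset XS; apply/subsetP=> t /setDP[].
        by rewrite -e => /setUP[|->].
      rewrite inE negb_or => /andP[yX yD] xy; case/setUP: xX => [xX|xD].
        by exists x, y; rewrite inE yD yS.
      by case/negP: yD; apply: closed xy => //; apply: contraNneq yX => ->.
    have /connP/(_ X) := cS; case=> [||| x [y [xX yS yX xy]]] //.
    - exact: subset_trans XS (subsetDl _ _).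
    - apply: contraNneq oX => ->; exact: oS.
    exists x, y; rewrite inE yS andbT; split=> //; apply/negP=> yD.
    have [xS /negP[]] := XD x xX; apply: (closed y x) => //; last by rewrite adj_sym.
    by apply: contraNneq oX => <-.
  by have := wS; rewrite -e inE wD.
have [rq rS etY] := RP rR; have [K1 rA1 n1] := qsetP rq; have A1S := clqS rR.
have /lowKP[_ cA1 kA1] := K1.
have [t tA1 tD] : exists2 t, t \in clq r & t \in D.
  case/subsetPn: nsub => t tA1; rewrite inE negb_and negbK (subsetP A1S) // orbF.
  by exists t.
have oA1 : o \notin clq r.
  apply/negP=> oA1; have e := lowK_inj KA K1 oA oA1.
  by have := disjointFr DA tD; rewrite e tA1.
have A1D : clq r \subset D.
  apply: (conn_sub_component wSo (conn_clique kA1) _ tA1 tD).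
  apply/subsetP=> s sA; rewrite !inE (subsetP A1S) // andbT.
  by apply: contraNneq oA1 => <-.
have [gr|ngr] := boolP (good r); first by exists r; rewrite // (subsetP A1D).
have [/exists_inP[o' o'A /exists_inP[w' w'S /andP[ow' oD']]]|/exists_inPn noall] :=
  boolP [exists o' in clq r, exists w' in S :\: clq r,
           adj o' w' && (o \notin component (S :\ o') w')].
  have w'So : w' \in S :\ o'.
    move: w'S; rewrite !inE => /andP[w'A ->]; rewrite andbT.
    by apply: contraNneq w'A => ->.
  have o'D := subsetP A1D _ o'A.
  have w'S1 : w' \in S by case/setDP: w'S.
  have w'D : w' \in D.
    apply: closed ow' => //; apply: contraNneq oD' => <-; exact: component_id.
  have D'D : component (S :\ o') w' \subset D.
    apply: (conn_sub_component wSo (component_conn w'So) _ (component_id _ _) w'D).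
    apply/subsetP=> s sD'; have /setD1P[_ sS] := subsetP (component_sub w'So) _ sD'.
    by rewrite !inE sS andbT; apply: contraNneq oD' => <-.
  have [||g gD' gg] := IH (clq r) o' w' _ K1 o'A _ w'S ow'.
  - apply: leq_trans hn; apply/proper_card/properP; split=> //; exists o' => //.
    by apply/negP=> /(subsetP (component_sub w'So)); rewrite !inE eqxx.
  - exact: (subsetP A1S).
  by exists g; rewrite // (subsetP D'D).
(* Now every branch at [clq r] contains [o]. Branches at two of its vertices would therefore be
   nested, and one would contain a vertex of the clique. Hence at least m - 1 >= 3 vertices are
   inner, one more than the two that can fail to be good. *)
have out1 : #|clq r :\: [set u in clq r | nbr S u \subset clq r]| <= 1.
  apply/card_le1_eqP=> o1 o2.
  have outP u : u \in clq r :\: [set u in clq r | nbr S u \subset clq r] ->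
      u \in clq r /\ exists2 z, z \in S :\: clq r & adj u z.
    rewrite !inE => /andP[+ uA]; rewrite uA /= => /subsetPn[z]; rewrite in_nbr => /andP[zS uz] zA.
    by split=> //; exists z; rewrite // inE zA.
  move=> /outP[o1A [w1 w1S ow1]] /outP[o2A [w2 w2S ow2]]; apply/eqP/negPn/negP=> o12.
  have hD u z : u \in clq r -> z \in S :\: clq r -> adj u z -> o \in component (S :\ u) z.
    by move=> uA zS uz; have /exists_inPn/(_ z zS) := noall u uA; rewrite uz /= negbK.
  have wSo' u z : u \in clq r -> z \in S :\: clq r -> z \in S :\ u.
    by move=> uA /setDP[zS zA]; rewrite !inE zS andbT; apply: contraNneq zA => ->.
  have dj u z : u \in clq r -> z \in S :\: clq r -> adj u z -> [disjoint component (S :\ u) z & clq r].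
    by move=> uA zS uz; apply: branch_disjoint.
  have sub21 : component (S :\ o2) w2 \subset component (S :\ o1) w1.
    apply: (conn_sub_component (wSo' _ _ o1A w1S) (component_conn (wSo' _ _ o2A w2S)) _
              (hD _ _ o2A w2S ow2) (hD _ _ o1A w1S ow1)).
    apply/subsetP=> s sD; have /setD1P[_ sS] := subsetP (component_sub (wSo' _ _ o2A w2S)) _ sD.
    rewrite !inE sS andbT; apply: contraTneq sD => ->.
    by rewrite (disjointFl (dj _ _ o2A w2S ow2) o1A).
  have : o2 \in component (S :\ o1) w1.
    apply: (component_closed (wSo' _ _ o1A w1S) (subsetP sub21 _ (component_id _ _))).
      by rewrite !inE o12 (subsetP A1S).
    by rewrite adj_sym.
  by rewrite (disjointFl (dj _ _ o1A w1S ow1) o2A).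
have gi := good_inner_card rR ngr.
have : 0 < #|[set u in clq r | (nbr S u \subset clq r) && good u]|.
  move: gi out1; rewrite cardsD.
  have -> : clq r :&: [set u in clq r | nbr S u \subset clq r] =
            [set u in clq r | nbr S u \subset clq r].
    by apply/setP=> u; rewrite !inE andbA andbb.
  rewrite cA1; natlia.
case/card_gt0P=> u; rewrite inE => /and3P[uA _ gu]; exists u => //.
exact: (subsetP A1D).
Qed.

(** Around a vertex that is not good, good vertices come from inside its clique by [good_inner_card]
    and from the branches at the clique by [branch_good]. *)
Lemma good_ge2 : 1 < #|R| -> 1 < #|[set r in R | good r]|.
Proof.
move=> R2; have [/forall_inP all|] := boolP [forall r in R, good r].
  apply: leq_trans R2 _; apply/subset_leq_card/subsetP=> r rR.
  by rewrite inE rR all.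
case/forall_inPn=> r rR ngr; have [rq rS etY] := RP rR; have [KA rA nA] := qsetP rq.
have AS := clqS rR; have /lowKP[_ cA kA] := KA.
pose Inn := [set u in clq r | nbr S u \subset clq r].
pose IG := [set u in clq r | (nbr S u \subset clq r) && good u].
have gi : #|Inn| <= 2 + #|IG| := good_inner_card rR ngr.
have goodR g : good g -> g \in [set r in R | good r].
  by move=> gg; rewrite inE gg andbT; case/andP: gg.
have IGg : IG \subset [set r in R | good r].
  by apply/subsetP=> u /setIdP[_ /andP[_ /goodR]].
have [Inn2|IG1] := ltnP 1 #|IG|; first exact: leq_trans Inn2 (subset_leq_card IGg).
have cO : #|clq r :\: Inn| = m - #|Inn|.
  rewrite cardsD cA; congr (_ - #|pred_of_set _|).
  by apply/setP=> u; rewrite /Inn !inE andbA andbb.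
have outP u : u \in clq r :\: Inn -> u \in clq r /\ exists2 z, z \in S :\: clq r & adj u z.
  rewrite /Inn !inE => /andP[+ uA]; rewrite uA /= => /subsetPn[z]; rewrite in_nbr => /andP[zS uz] zA.
  by split=> //; exists z; rewrite // inE zA.
have branch u z : u \in clq r -> z \in S :\: clq r -> adj u z ->
    [/\ z \in S :\ u, [disjoint component (S :\ u) z & clq r] &
        exists2 g, g \in component (S :\ u) z & good g].
  move=> uA zS uz; split; last exact: (branch_good KA uA (subsetP AS _ uA) zS uz).
    by case/setDP: zS => zS zA; rewrite !inE zS andbT; apply: contraNneq zA => ->.
  exact: branch_disjoint.
(* Branches at two different clique vertices are disjoint, so each supplies its own good vertex. *)
have [O2|O1] := ltnP 1 #|clq r :\: Inn|.
  have /card_gt1P[o1 [o2 [/outP[o1A [w1 w1S ow1]] /outP[o2A [w2 w2S ow2]] o12]]] := O2.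
  have [w1o d1 [g1 g1D gg1]] := branch _ _ o1A w1S ow1.
  have [w2o d2 [g2 g2D gg2]] := branch _ _ o2A w2S ow2.
  apply/card_gt1P; exists g1, g2; split; try exact: goodR.
  apply/eqP=> e; rewrite -e in g2D.
  have sub21 : component (S :\ o2) w2 \subset component (S :\ o1) w1.
    apply: (conn_sub_component w1o (component_conn w2o) _ g2D g1D).
    apply/subsetP=> s sD; have /setD1P[_ sS] := subsetP (component_sub w2o) _ sD.
    rewrite !inE sS andbT; apply: contraTneq sD => ->.
    by rewrite (disjointFl d2 o1A).
  have : o2 \in component (S :\ o1) w1.
    apply: (component_closed w1o (subsetP sub21 _ (component_id _ _))).
      by rewrite !inE eq_sym o12 (subsetP AS).
    by rewrite adj_sym.
  by rewrite (disjointFl d1 o2A).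
(* With at most one good inner vertex, at most three are inner, so m >= 4 leaves an outer one;
   having only one outer vertex leaves at least three inner ones, one of them good. *)
have [o /outP[oA [w wS ow]]] : exists o, o \in clq r :\: Inn.
  by apply/card_gt0P; move: cO gi IG1 m_ge4; natlia.
have [u uI] : exists u, u \in IG by apply/card_gt0P; move: cO gi O1 m_ge4; natlia.
have [_ d [g gD gg]] := branch _ _ oA wS ow.
apply/card_gt1P; exists u, g; split; [exact: (subsetP IGg) | exact: goodR |].
apply: contraTneq gD => <-; rewrite (disjointFl d) //.
by case/setIdP: uI.
Qed.

End GoodVertices.

(** * Charging components to vertices of degree k *)

Lemma component_eq (S : {set G}) w x : w \in S -> x \in component S w -> component S x = component S w.
Proof.
move=> wS xD; have xS := subsetP (component_sub wS) _ xD.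
apply/eqP; rewrite eqEsubset; apply/andP; split.
  exact: (conn_sub_component wS (component_conn xS) (component_sub xS) (component_id _ _)).
apply: (conn_sub_component xS (component_conn wS) (component_sub wS) xD).
exact: component_id.
Qed.

Lemma qset_high_bound :
  #|[set v in qset | deg (eta v) == m.+1]| <=
  #|component low @: qset| + 3 * #|[set v : G | deg v == m.+1]|.
Proof.
set P := [set v in qset | _]; rewrite leqNgt; apply/negP=> hP.
have Pq : P \subset qset by apply/subsetP=> v /setIdP[].
have Pd v : v \in P -> deg (eta v) = m.+1 by case/setIdP=> _ /eqP.
(* The weights 1 and 3 leave at least two edges at each component and at least four at each vertex
   of [Y]. *)
have [|Q [QP Q0 Qf]] := @extract_fibers _ _ _ P (component low) eta 1 3.
  apply: leq_ltn_trans hP; rewrite mul1n; apply: leq_add.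
    by apply/subset_leq_card/imsetS.
  rewrite leq_mul2l; apply/orP; right; apply/subset_leq_card/subsetP=> y /imsetP[v vP ->].
  by rewrite inE Pd.
have Qq v : v \in Q -> v \in qset by move=> vQ; apply: (subsetP Pq); apply: (subsetP QP).
have Ql v : v \in Q -> v \in low by move=> /Qq/qset_low.
pose Y := eta @: Q; pose TT : {set {set G}} := component low @: Q.
have degY y : y \in Y -> deg y = m.+1 by case/imsetP=> v /(subsetP QP)/Pd ? ->.
have TTP (T : {set G}) : T \in TT -> T \subset low /\ conn T.
  by case/imsetP=> v /Ql vl ->; split; [exact: component_sub | exact: component_conn].
have TTe (T : {set G}) x : T \in TT -> x \in T -> component low x = T.
  by case/imsetP=> v /Ql vl -> xT; apply: component_eq.
pose RT (T : {set G}) := [set v in qset | (v \in T) && (eta v \in Y)].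
have clqT (T : {set G}) r : T \in TT -> r \in RT T -> clq r \subset T.
  move=> TD; rewrite inE => /and3P[rq rT _]; have [/lowKP[Al _ kA] rA _] := qsetP rq.
  case/imsetP: TD rT => v /Ql vl -> rT.
  exact: (conn_sub_component vl (conn_clique kA) Al rA rT).
pose pr (T S' : {set G}) := [&& S' \subset T, conn S' & [forall r in RT T, clq r \subset S']].
pose S (T : {set G}) : {set G} := odflt set0 [pick S' | minset (pr T) S'].
have SP (T : {set G}) : T \in TT -> minset (pr T) (S T).
  move=> TD; rewrite /S; case: pickP => //= none.
  have [|S' mS' _] := @minset_exists _ (pr T) T; last by rewrite none in mS'.
  by rewrite /pr subxx (TTP T TD).2 /=; apply/forall_inP=> r; apply: clqT.
have ST (T : {set G}) : T \in TT -> S T \subset T by move/SP/minsetp/and3P=> [].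
have Sc (T : {set G}) : T \in TT -> conn (S T) by move/SP/minsetp/and3P=> [].
have Sl (T : {set G}) : T \in TT -> S T \subset low.
  by move=> TD; apply: subset_trans (ST T TD) (TTP T TD).1.
have RS (T : {set G}) r : T \in TT -> r \in RT T -> clq r \subset S T.
  by move=> TD; have /minsetp/and3P[_ _ /forall_inP h] := SP T TD; apply: h.
have RTE (T : {set G}) : T \in TT -> RT T = [set v in qset | (v \in S T) && (eta v \in Y)].
  move=> TD; apply/setP=> r; apply/idP/idP=> [rR|]; last first.
    by rewrite !inE => /and3P[-> /(subsetP (ST T TD)) -> ->].
  have rS : r \in S T.
    apply: (subsetP (RS T r TD rR)).
    by case/setIdP: rR => /qsetP[].
  by move: rR; rewrite !inE rS => /and3P[-> _ ->].
have QR v : v \in Q -> v \in RT (component low v).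
  by move=> vQ; apply/setIdP; rewrite component_id imset_f // Qq.
have TTv v : v \in Q -> component low v \in TT by move=> vQ; apply: imset_f.
have R2 (T : {set G}) : T \in TT -> 1 < #|RT T|.
  move=> /imsetP[v vQ ->]; have [h _] := Qf v vQ; apply: leq_trans h _.
  apply/subset_leq_card/subsetP=> z; rewrite inE => /andP[zQ /eqP <-]; exact: QR.
pose GS (T : {set G}) := [set r in [set v in qset | (v \in S T) && (eta v \in Y)] | good Y (S T) r].
have GS2 (T : {set G}) : T \in TT -> 1 < #|GS T|.
  move=> TD; apply: good_ge2 => //; rewrite -?RTE //; last exact: R2.
  - exact: Sl.
  - exact: Sc.
  - by move=> r; apply: RS.
  - move=> S' S'S cS' h; have /minsetinf := SP T TD; apply=> //.
    by rewrite /pr (subset_trans S'S (ST T TD)) cS'; apply/forall_inP.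
pose U := \bigcup_(T in TT) S T.
(* The cliques carrying edges of [Q] survive the pruning, so [y] keeps these four neighbours. *)
have nbrU y : y \in Y -> 4 <= #|nbr U y|.
  case/imsetP=> v vQ ->; have [_ h] := Qf v vQ; apply: leq_trans h _.
  apply/subset_leq_card/subsetP=> z; rewrite inE => /andP[zQ /eqP e].
  have [ze _] := etaP (Qq z zQ); rewrite in_nbr -e adj_sym ze andbT.
  apply/bigcupP; exists (component low z); first exact: TTv.
  apply: (subsetP (RS _ _ (TTv z zQ) (QR z zQ))).
  by have [] := qsetP (Qq z zQ).
have [v0 v0Q] := set0Pn _ Q0.
have GSP (T : {set G}) v : v \in GS T -> [/\ v \in qset, v \in S T, eta v \in Y & good Y (S T) v].
  by case/setIdP => /setIdP[-> /andP[-> ->]] ->.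
(* Count the edges at good vertices: at least two per component and at most d at a [y] with d
   neighbours in [U]. Hall's condition follows from d <= 2(d - 2), which is d >= 4. *)
have [|p [pN pc]] := @hall_capacity _ _ v0 (fun T : {set G} => eta @: GS T) TT (fun y => #|nbr U y| - 2).
  move=> SS SST; pose W := \bigcup_(T in SS) GS T.
  have h1 : 2 * #|SS| <= #|W|.
    rewrite -[#|W|]sum1_card (partition_big (component low) (mem SS)) /=; last first.
      move=> v /bigcupP[T TS /GSP[_ vS _ _]].
      by rewrite (TTe T v) // ?(subsetP SST) //; apply: (subsetP (ST T _)); rewrite ?(subsetP SST).
    rewrite mulnC -sum_nat_const; apply: leq_sum => T TS; have TD := subsetP SST _ TS.
    apply: leq_trans (GS2 T TD) _; rewrite sum1_card; apply/subset_leq_card/subsetP=> v vG.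
    rewrite unfold_in; apply/andP; split; first by apply/bigcupP; exists T.
    by have [_ /(subsetP (ST T TD)) vT _ _] := GSP T v vG; rewrite (TTe T v).
  have h2 : #|W| <= \sum_(y in \bigcup_(T in SS) (eta @: GS T)) #|nbr U y|.
    rewrite -[#|W|]sum1_card (partition_big eta (mem (\bigcup_(T in SS) (eta @: GS T)))) /=.
      apply: leq_sum => y _; rewrite sum1_card; apply/subset_leq_card/subsetP=> v.
      rewrite unfold_in => /andP[/bigcupP[T TS /GSP[vq vS _ _]] /eqP <-].
      have [ve _] := etaP vq; rewrite in_nbr adj_sym ve andbT.
      by apply/bigcupP; exists T => //; apply: (subsetP SST).
    by move=> v /bigcupP[T TS vG]; apply/bigcupP; exists T => //; apply: imset_f.
  rewrite -(leq_pmul2l (_ : 0 < 2)) //; apply: leq_trans h1 _; apply: leq_trans h2 _.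
  rewrite big_distrr /=; apply: leq_sum => y /bigcupP[T TS /imsetP[v /GSP[_ _ vY _] e]].
  by rewrite -e in vY; have := nbrU y vY; natlia.
have /fin_all_exists[vu vuP] T : exists vu : G * G, T \in TT ->
   [/\ vu.1 \in GS T, eta vu.1 = p T, vu.2 \in clq vu.1, nbr (S T) vu.2 \subset clq vu.1 &
       forall y, y \in Y -> adj vu.2 y -> rank y < rank (p T)].
  case TD: (T \in TT); last by exists (v0, v0).
  have /imsetP[v vG e] := pN T TD; have [_ _ _ /andP[_ /exists_inP[u uA /andP[nu /forall_inP h]]]] := GSP T v vG.
  exists (v, u) => _; split=> // y yY uy; rewrite e; move: (h y yY).
  by rewrite uy.
apply: (@payers_contradiction _ Y TT S (fun T => clq (vu T).1) p (fun T => (vu T).1) (fun T => (vu T).2)) => //.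
- by apply/set0Pn; exists (eta v0); apply: imset_f.
- by move=> T TD; split; [exact: Sl | exact: Sc].
- move=> T T' x y TD T'D xS yS xy.
  have xT := subsetP (ST T TD) _ xS; have yT := subsetP (ST T' T'D) _ yS.
  rewrite -(TTe T' y T'D yT) -(TTe T x TD xT) (@component_eq low x y) //.
    exact: (subsetP (Sl T TD)).
  apply: (@component_closed _ low x x y) => //; first exact: (subsetP (Sl T TD)).
    exact: component_id.
  exact: (subsetP (Sl T' T'D)).
- move=> T TD; have [vG _ _ _ _] := vuP T TD; have [vq vS vY _] := GSP _ _ vG.
  have [KA _ _] := qsetP vq; split=> //; apply: RS => //.
  by rewrite RTE //; apply/setIdP; rewrite vS vY.
- move=> T TD; have [vG _ uA nu _] := vuP T TD; have [vq vS vY _] := GSP _ _ vG.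
  have [_ vA nA] := qsetP vq; split=> //.
  by apply: subset_trans nA; apply: nbrS; apply: Sl.
- move=> T TD; have [vG e _ _ h] := vuP T TD; have [vq _ vY _] := GSP _ _ vG.
  by have [ve _] := etaP vq; rewrite -e; split=> //; rewrite e.
- move=> y yY; have h : 2 <= #|nbr U y| by apply: leq_trans (nbrU y yY).
  by rewrite -(subnK h) leq_add2r; apply: pc.
Qed.

(** * Translation to the graph invariants *)

(** The edge from [v] to [eta v] determines [v], its only low end. *)
Lemma card_qset_plus :
  #|[set v in qset | m.+2 <= deg (eta v)]| <=
  edges_between (induced [set v : G | m.+2 <= deg v]) (induced low).
Proof.
rewrite -(@card_in_imset _ _ (fun v => [set eta v; v])) => [|v v' /setIdP[vq _] /setIdP[vq' _] e].
  apply/subset_leq_card/subsetP=> _ /imsetP[v /setIdP[vq hd] ->].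
  have [ve _] := etaP vq; rewrite inE in_edges adj_sym ve /=.
  apply/exists_inP; exists (eta v); rewrite ?inE //.
  by apply/exists_inP; exists v; rewrite ?qset_low.
have /set2P[ve|//] : v \in [set eta v'; v'] by rewrite -e set22.
by have [_] := etaP vq'; rewrite -ve qset_low.
Qed.

Lemma card_qset_split :
  #|qset| <= #|[set v in qset | deg (eta v) == m.+1]| + #|[set v in qset | m.+2 <= deg (eta v)]|.
Proof.
apply: leq_trans (leq_card_setU _ _).1; apply/subset_leq_card/subsetP=> v vq.
have [_] := etaP vq; rewrite /low inE => ne; rewrite in_setU.
have := deg_ge (eta v); rewrite leq_eqVlt eq_sym (negPf ne) /= leq_eqVlt eq_sym => /orP[h|h].
  by apply/orP; left; apply/setIdP.
by apply/orP; right; apply/setIdP.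
Qed.

Definition trace (A : {set G}) : {set induced low} := [set x | val x \in A].

Lemma val_trace A : A \subset low -> val @: trace A = A.
Proof.
move=> Al; apply/setP=> a; apply/imsetP/idP => [[x + ->]|aA]; first by rewrite inE.
by exists (Sub a (subsetP Al a aA)); rewrite ?inE SubK.
Qed.

Lemma card_trace A : A \subset low -> #|trace A| = #|A|.
Proof. by move=> Al; rewrite -[in RHS](val_trace Al) card_imset //; apply: val_inj. Qed.

Lemma connect_low (x y : induced low) :
  connect (@adj (induced low)) x y = connect (adjin low) (val x) (val y).
Proof.
apply/idP/idP; last first.
  case/connectP=> p; elim: p x => [|b p IH] x /=.
    by move=> _ /val_inj ->; apply: connect0.
  case/andP=> /and3P[xl bl xb] hp hy.
  apply: (@connect_trans _ _ (Sub b bl : induced low)).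
    by apply: connect1; apply: etrans (induced_adj x (Sub b bl)) _; rewrite SubK.
  exact: IH.
apply: connect_map => a b ab; apply/and3P; split; [exact: (valP a) | exact: (valP b) |].
by rewrite -induced_adj.
Qed.

Lemma card_component_cstar :
  #|component low @: qset| <= cstar m.+1 (induced low).
Proof.
rewrite -(@card_in_imset _ _ trace) => [|T T'].
  apply/subset_leq_card/subsetP=> _ /imsetP[_ /imsetP[v vq ->] ->].
  have vl := qset_low vq; have [KA vA _] := qsetP vq; have /lowKP[Al cA kA] := KA.
  rewrite inE; apply/andP; split.
    apply/imsetP; exists (Sub v vl : induced low); rewrite ?inE //.
    by apply/setP=> y; rewrite !inE connect_low SubK.
  apply/existsP; exists (trace (clq v)); apply/andP; split.
    apply/is_KP; split; first by rewrite card_trace.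
    move=> x y; rewrite !inE => xA yA xy; rewrite induced_adj; apply: kA => //.
  apply/subsetP=> x; rewrite inE => xA; rewrite inE.
  apply: subsetP xA; apply: (conn_sub_component vl (conn_clique kA) Al vA).
  exact: component_id.
move=> /imsetP[v /qset_low vl ->] /imsetP[v' /qset_low vl' ->] e.
by rewrite -(val_trace (component_sub vl)) e val_trace // component_sub.
Qed.

(** If [v] had a low neighbour outside its clique, [branch_disjoint] would separate that neighbour
    from the rest of the clique in [induced low] without [v], making [v] a cutvertex. *)
Lemma card_q_qset : q m.+1 (induced low) <= #|qset|.
Proof.
rewrite /q -(card_imset _ val_inj); apply/subset_leq_card/subsetP=> _ /imsetP[v + ->].
rewrite inE => /andP[ncut /existsP[K /andP[/is_KP[cK kK] vK]]].
have KA : lowK (val @: K).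
  apply/lowKP; split.
  - by apply/subsetP=> _ /imsetP[x _ ->]; apply: (valP x).
  - by rewrite card_imset //; apply: val_inj.
  - move=> _ _ /imsetP[x xK ->] /imsetP[y yK ->] xy; rewrite -induced_adj.
    by apply: kK => //; apply: contra xy => /eqP ->.
rewrite inE; apply/existsP; exists (val @: K); rewrite KA imset_f //=.
apply: contraR ncut => /subsetPn[w]; rewrite in_nbr => /andP[wl vw] wK.
have [a aK av] : exists2 a, a \in K & a != v.
  have : 0 < #|K :\ v| by move: (cardsD1 v K); rewrite vK cK /= => e; rewrite -(ltn_add2l 1) -e; natlia.
  by case/card_gt0P=> a /setD1P[av aK]; exists a.
apply: (@separates_cutvertex (induced low) v (Sub w wl) a).
- by rewrite induced_adj SubK.
- by apply: kK; rewrite // eq_sym.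
move=> w' a' ew ea; apply/negP=> hc.
have wl' : w \in low :\: val @: K by rewrite inE wK.
have := branch_disjoint KA (subxx _) (imset_f _ vK) wl' vw.
move/disjointFl/(_ (imset_f _ aK)); rewrite inE => /negP; apply.
have -> : w = val (val w') by rewrite ew SubK.
have out (z : @induced (induced low) [set~ v]) : val (val z) \in low :\ val v.
  rewrite in_setD1; apply/andP; split; last exact: (valP (val z)).
  by have := valP z; rewrite /= in_setC1; apply: contra => /eqP/val_inj ->.
rewrite -ea; apply: (connect_map (h := fun z : @induced (induced low) [set~ v] => val (val z))) hc => x y xy.
by rewrite /adjin !out -!induced_adj.
Qed.

End Critical.

Theorem lemma1p1 (k : nat) (G : sgraph) (hk : 5 <= k)
    (hcrit : list_critical k G) (hG : ~~ complete G) :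
  let L := induced [set v : G | deg v == k.-1] in
  let Hminus := induced [set v : G | deg v == k] in
  let Hplus := induced [set v : G | k.+1 <= deg v] in
  q k L <= cstar k L + 4 * nverts Hminus + edges_between Hplus L /\
  (7 <= k ->
   q k L <= 2 * cstar k L + 3 * nverts Hminus + edges_between Hplus L).
Proof.
case: k hk hcrit => [//|m] hm hcrit /=.
rewrite nverts_induced -/(low G m).
have hq := card_q_qset hm hcrit hG; have hs := card_qset_split hm hcrit hG.
have hp := card_qset_plus hm hcrit hG; have hc := card_component_cstar hm hcrit hG.
have hh := qset_high_bound hm hcrit hG.
have main : q m.+1 (induced (low G m)) <= cstar m.+1 (induced (low G m)) +
    3 * #|[set v : G | deg v == m.+1]| +
    edges_between (induced [set v : G | m.+2 <= deg v]) (induced (low G m)).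
  apply: leq_trans hq _; apply: leq_trans hs (leq_add _ hp).
  by apply: leq_trans hh _; rewrite leq_add2r.
split=> [|_]; apply: leq_trans main _; rewrite leq_add2r.
  by rewrite leq_add2l leq_mul2r orbT.
by rewrite leq_add2r leq_pmull.
Qed.
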